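(* $\mathrm{AoUC}_{[0,1]}^* \equiv_{\mathrm{W}} \mathrm{BRoot}^*$.
   Context: Computable analysis setting: represented spaces; reals represented by rational sequences $(q_n)$ with $|q_n - x| < 2^{-n}$. $f \le_{\mathrm{W}} g$ (Weihrauch reducibility) means there are computable partial maps $H,K$ on names such that for every realizer $G$ of $g$, $p \mapsto H(p, G(K(p)))$ realizes $f$; $\equiv_{\mathrm{W}}$ means reducibility in both directions. $f^*$: given $n\in\mathbb{N}$ and $n$ inputs for $f$, output a tuple of corresponding valid outputs. $\mathrm{AoUC}_{[0,1]}$: input a closed set $A \subseteq [0,1]$ given by an enumeration of rational open intervals exhausting $[0,1]\setminus A$, promised to be either $[0,1]$ or a singleton; output any $x \in A$. Real univariate polynomials are represented by an upper bound on the degree together with the tuple of (real) coefficients up to that bound (so the exact degree is not known). $\mathrm{BRoot}$ maps a real univariate polynomial $p$ to some root of $p$ in $[0,1]$ if $p$ has one there; if $p$ has no root in $[0,1]$, any $x \in [0,1]$ is a valid output. *)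

(* Defs.v *)
From Stdlib Require List Cantor.
From mathcomp Require Import all_boot all_order all_algebra.
From mathcomp Require Import all_classical all_reals all_analysis.
Set Implicit Arguments.
Unset Strict Implicit.
Unset Printing Implicit Defensive.
Import Order.TTheory GRing.Theory Num.Theory.
Import numFieldNormedType.Exports.
Local Open Scope classical_set_scope.
Local Open Scope ring_scope.

Definition baire := nat -> nat.

(* Kleene's mu-recursive functions relative to an oracle.  Arguments are passed
   as a list; [Prec f g] recurses on the first argument, [g] receiving the
   predecessor, the previous value and the parameters in this order. *)
Inductive code : Type :=
| Zero
| Succ
| Proj of nat
| Query
| Comp of code & seq code
| Prec of code & code
| Mu of code.

(* [eval p c s y]: with oracle p, the program c halts on s with output y. *)
Inductive eval (p : baire) : code -> seq nat -> nat -> Prop :=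
| eval_zero s : eval p Zero s 0%N
| eval_succ x s : eval p Succ (x :: s) x.+1
| eval_proj i s : (i < size s)%N -> eval p (Proj i) s (nth 0%N s i)
| eval_query x s : eval p Query (x :: s) (p x)
| eval_comp f gs s ys y :
    List.Forall2 (fun g => eval p g s) gs ys -> eval p f ys y ->
    eval p (Comp f gs) s y
| eval_prec0 f g s y : eval p f s y -> eval p (Prec f g) (0%N :: s) y
| eval_precS f g s n y z :
    eval p (Prec f g) (n :: s) y -> eval p g [:: n, y & s] z ->
    eval p (Prec f g) (n.+1 :: s) z
| eval_mu f s n (w : nat -> nat) :
    (forall m, (m < n)%N -> eval p f (m :: s) (w m).+1) ->
    eval p f (n :: s) 0%N -> eval p (Mu f) s n.

(* Partial maps on Baire space; [None] means undefined. *)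
Definition pmap_baire := baire -> option baire.

(* As usual in computable analysis, the machine is only constrained on the
   domain of F. *)
Definition computable (F : pmap_baire) : Prop :=
  exists c : code, forall p q, F p = Some q ->
    forall n, eval p c [:: n] (q n).

Definition pair_baire (p q : baire) : baire :=
  fun n => if odd n then q n./2 else p n./2.

(* The i-th component of the names packed in p; position 0 of p is reserved for
   a natural number (a length or a degree bound). *)
Definition slice (p : baire) (i : nat) : baire :=
  fun k => p (Cantor.to_nat (i, k)).+1.

(* A representation is a partial surjection from Baire space, given here by its
   graph. *)
Record rep_space := RepSpace {
  rep_car :> Type;
  names : baire -> rep_car -> Prop;
  names_fun : forall p x y, names p x -> names p y -> x = y;
  names_surj : forall x, exists p, names p x }.

(* Multivalued partial functions; the domain consists of the x for which some
   y is allowed. *)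
Definition problem (X Y : rep_space) := X -> Y -> Prop.

Definition realizes (X Y : rep_space) (F : pmap_baire) (f : problem X Y) :=
  forall p x, names p x -> (exists y, f x y) ->
    exists q y, [/\ F p = Some q, names q y & f x y].

Definition weihrauch_le (X Y Z W : rep_space)
    (f : problem X Y) (g : problem Z W) : Prop :=
  exists H K : pmap_baire, [/\ computable H, computable K &
    forall G : pmap_baire, realizes G g ->
      realizes (fun p => obind (fun k =>
                  obind (fun r => H (pair_baire p r)) (G k)) (K p)) f].

Definition weihrauch_equiv (X Y Z W : rep_space)
    (f : problem X Y) (g : problem Z W) : Prop :=
  weihrauch_le f g /\ weihrauch_le g f.

Section Subspace.
Variables (X : rep_space) (P : X -> Prop).

Definition sub_names (p : baire) (x : {x : X | P x}) := names p (sval x).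

Lemma sub_names_fun p x y : sub_names p x -> sub_names p y -> x = y.
Proof.
by case: x y => [x Px] [y Py] hx hy; apply: eq_exist; exact: names_fun hx hy.
Qed.

Lemma sub_names_surj x : exists p, sub_names p x.
Proof. exact: names_surj. Qed.

Definition sub_space := RepSpace sub_names_fun sub_names_surj.
End Subspace.

Section Words.
Variable X : rep_space.

Definition seq_names (p : baire) (xs : seq X) : Prop :=
  p 0%N = size xs /\ forall i x, onth xs i = Some x -> names (slice p i) x.

Lemma seq_names_fun p xs ys : seq_names p xs -> seq_names p ys -> xs = ys.
Proof.
move=> [sx hx] [sy hy]; apply/(eq_onthP 0%N 2%N) => i.
case ex: (onth xs i) => [x|]; case ey: (onth ys i) => [y|] //.
- by rewrite (names_fun (hx _ _ ex) (hy _ _ ey)).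
- by have := onthTE xs i; rewrite ex -sx sy -onthTE ey.
- by have := onthTE ys i; rewrite ey -sy sx -onthTE ex.
Qed.

Lemma seq_names_surj xs : exists p, seq_names p xs.
Proof.
have /choice [nm nmP] : forall i : nat, exists p : baire,
    forall x, onth xs i = Some x -> names p x.
  move=> i; case: (onth xs i) => [x|]; last by exists id.
  by have [p hp] := names_surj x; exists p => _ [<-].
exists (fun n => if n is m.+1 then let: (i, k) := Cantor.of_nat m in nm i k
                 else size xs); split=> // i x /nmP.
by congr names; apply/funext => k; rewrite /slice Cantor.cancel_of_to.
Qed.

Definition seq_space := RepSpace seq_names_fun seq_names_surj.
End Words.

Definition star (X Y : rep_space) (f : problem X Y) :
    problem (seq_space X) (seq_space Y) :=
  fun xs ys => List.Forall2 f xs ys.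

(* c = <<a, b>, d> denotes (a - b) / (d + 1). *)
Definition rat_of_code (c : nat) : rat :=
  let: (n, d) := Cantor.of_nat c in
  let: (a, b) := Cantor.of_nat n in
  (a%:R - b%:R) / d.+1%:R.

Lemma rat_of_code_surj (q : rat) : exists c, rat_of_code c = q.
Proof.
pose d := (`|denq q|.-1)%N.
have dE : d.+1%:R = (denq q)%:~R :> rat.
  by rewrite /d prednK ?absz_gt0 ?denq_neq0// pmulrn absz_denq.
case nE : (numq q) => [a|b].
- exists (Cantor.to_nat (Cantor.to_nat (a, 0%N), d)).
  rewrite /rat_of_code !Cantor.cancel_of_to dE subr0.
  by rewrite -[RHS]divq_num_den nE.
- exists (Cantor.to_nat (Cantor.to_nat (0%N, b.+1), d)).
  rewrite /rat_of_code !Cantor.cancel_of_to dE sub0r.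
  by rewrite -[RHS]divq_num_den nE NegzE mulrNz.
Qed.

Section Spaces.
Variable R : realType.

Definition real_names (p : baire) (x : R) : Prop :=
  forall n, `|ratr (rat_of_code (p n)) - x| < 2^-1 ^+ n.

Lemma real_names_fun p x y : real_names p x -> real_names p y -> x = y.
Proof.
move=> hx hy; apply/eqP; rewrite -subr_eq0 -normr_le0; apply/ler_addgt0Pr => e e0.
rewrite add0r.
have [n _ hn] : \forall n \near \oo, `|(2^-1 : R) ^+ n| < e / 2.
  have := @cvg_geometric _ (1 : R) (2^-1).
  rewrite ger0_norm ?invr_ge0// invf_lt1 ?ltr1n// => /(_ isT)/cvgrPdist_lt.
  move=> /(_ (e / 2)); rewrite divr_gt0// => /(_ isT).
  by apply: filterS => n; rewrite sub0r normrN /geometric/= mul1r.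
have := hn n (leqnn n); rewrite ger0_norm ?exprn_ge0 ?invr_ge0// => hn'.
have -> : x - y = (x - ratr (rat_of_code (p n))) + (ratr (rat_of_code (p n)) - y).
  by rewrite addrA subrK.
apply: (le_trans (ler_normD _ _)); rewrite [leRHS]splitr distrC.
by apply: lerD; apply: ltW; [apply: lt_trans (hx n) _|apply: lt_trans (hy n) _].
Qed.

Lemma real_names_surj x : exists p, real_names p x.
Proof.
suff /choice [p hp] : forall n, exists c,
    `|ratr (rat_of_code c) - x| < (2^-1 : R) ^+ n by exists p.
move=> n; have e0 : 0 < (2^-1 : R) ^+ n by rewrite exprn_gt0 ?invr_gt0.
have /rat_in_itvoo [q] : x - 2^-1 ^+ n < x + 2^-1 ^+ n.
  by rewrite ltrBlDr -addrA ltrDl addr_gt0.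
rewrite in_itv/= => hq; have [c cE] := rat_of_code_surj q.
by exists c; rewrite cE ltr_distl.
Qed.

Definition real_space := RepSpace real_names_fun real_names_surj.

Definition unit_interval := sub_space (X := real_space) (fun x : R => 0 <= x <= 1).

(* Degenerate codes (a >= b) denote the empty interval. *)
Definition itv_of_code (c : nat) : set R :=
  let: (a, b) := Cantor.of_nat c in
  `]ratr (rat_of_code a), ratr (rat_of_code b)[%classic.

Definition closed_unit_subset :=
  {A : set R | closed A /\ A `<=` `[0, 1]%classic}.

Definition closed_names (p : baire) (A : closed_unit_subset) : Prop :=
  `[0, 1]%classic `&` \bigcup_n itv_of_code (p n) =
  `[0, 1]%classic `\` sval A.

Lemma closed_names_fun p A B : closed_names p A -> closed_names p B -> A = B.
Proof.
case: A B => [A [cA sA]] [B [cB sB]]; rewrite /closed_names /= => -> hAB.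
apply: eq_exist; apply/seteqP; split => x Cx; apply: contrapT => nCx.
- by have : (`[0, 1]%classic `\` B) x by [split=> //; exact: sA]; rewrite -hAB => -[].
- by have : (`[0, 1]%classic `\` A) x by [split=> //; exact: sB]; rewrite hAB => -[].
Qed.

Lemma closed_names_surj A : exists p, closed_names p A.
Proof.
case: A => [A [cA sA]].
have itv0 : itv_of_code 0 = set0.
  by rewrite /itv_of_code/= set_itv_ge// bnd_simp ltxx.
exists (fun n => if `[< itv_of_code n `&` A = set0 >] then n else 0%N).
rewrite /closed_names /=; apply/seteqP; split => x [x01].
- case=> n _; case: asboolP => [nA nx|_]; last by rewrite itv0.
  by split=> // Ax; have : (itv_of_code n `&` A) x by []; rewrite nA.
- move=> nAx; split=> //.
  have /nbhs_ballP[e /= e0 he] : nbhs x (~` A).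
    by apply: open_nbhs_nbhs; split => //; exact/closed_openC.
  have /rat_in_itvoo[a] : x - e < x by rewrite ltrBlDr ltrDl.
  have /rat_in_itvoo[b] : x < x + e by rewrite ltrDl.
  rewrite !in_itv/= => /andP[xb bxe] /andP[xea ax].
  have [ca caE] := rat_of_code_surj a; have [cb cbE] := rat_of_code_surj b.
  exists (Cantor.to_nat (ca, cb)) => //.
  have cE : itv_of_code (Cantor.to_nat (ca, cb)) = `]ratr a, ratr b[%classic.
    by rewrite /itv_of_code Cantor.cancel_of_to caE cbE.
  case: asboolP => [_|[]]; first by rewrite cE /= in_itv/= ax xb.
  rewrite cE; apply/seteqP; split => // y [/=]; rewrite in_itv/= => /andP[ay yb].
  apply/he; rewrite /ball/= distrC ltr_distl.
  by rewrite (lt_trans xea)// (lt_trans yb).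
Qed.

Definition closed_unit_space := RepSpace closed_names_fun closed_names_surj.

(* The name packs a degree bound N and names of the coefficients of degree 0 to
   N, so that leading zeros are allowed. *)
Definition poly_names (p : baire) (P : {poly R}) : Prop :=
  (size P <= (p 0%N).+1)%N /\
  forall i, (i <= p 0%N)%N -> real_names (slice p i) P`_i.

Lemma poly_names_fun p P Q : poly_names p P -> poly_names p Q -> P = Q.
Proof.
move=> [sP hP] [sQ hQ]; apply/polyP => i; case: (leqP i (p 0%N)) => hi.
- exact: real_names_fun (hP i hi) (hQ i hi).
- by rewrite !nth_default // (leq_trans _ hi).
Qed.

Lemma poly_names_surj P : exists p, poly_names p P.
Proof.
have /choice [nm nmP] := fun i : nat => real_names_surj P`_i.
exists (fun n => if n is m.+1 then let: (i, k) := Cantor.of_nat m in nm i k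
                 else size P); split=> // i _.
by move: (nmP i); congr real_names; apply/funext => k;
  rewrite /slice Cantor.cancel_of_to.
Qed.

Definition poly_space := RepSpace poly_names_fun poly_names_surj.

Definition AoUC : problem closed_unit_space unit_interval :=
  fun A x => (sval A = `[0, 1]%classic \/ exists a, sval A = [set a]) /\
             sval A (sval x).

Definition BRoot : problem poly_space unit_interval :=
  fun P x => (exists y, 0 <= y <= 1 /\ root P y) -> root P (sval x).
End Spaces.

(* Main.v *)
(** AoUC* <= BRoot*: a component A becomes the linear polynomial b X - a, where
    b = 2^-n if the n-th listed interval is the first one meeting [0,1], b = 0 if
    there is none, and a = b x when A = {x}.  Both are computable, because x is
    once an interval has been seen, and any root in [0,1] is a point of A.

    BRoot* <= AoUC*: for a polynomial P of degree at most N and a sign vector s,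
    consider A_s = {x in [0,1] : P(x) = 0 and s_k P^(k)(x) >= 0 for 1 <= k <= N}.
    By Thom's lemma A_s has at most one point unless P = 0, when it is [0,1], and
    every root lies in some A_s; the exact degree plays no role.  Emptiness of A_s
    is detected after finitely many steps by compactness, and an instance that
    turns out empty is replaced by a point not excluded so far.  A nonempty A_s
    is selected with one further instance per s, deciding between "A_s is
    nonempty" and "A_t is nonempty for some earlier t": it becomes {0} or {1}
    when one of the alternatives is refuted. *)

From Stdlib Require List Cantor.
From mathcomp Require Import all_boot all_order all_algebra.
From mathcomp Require Import zify ring lra polyrcf all_analysis.
Require Import Defs.
From mathcomp Require Import all_classical all_reals.

Set Implicit Arguments.
Unset Strict Implicit.
Unset Printing Implicit Defensive.

(** * Uniform computability *)

(* An element of an environment carries an oracle and, as arguments, the values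
   of the variables in scope; binders extend the environment with [ext], the
   newest variable coming first. *)
Record env := Env {
  car :> Type;
  orc : car -> baire;
  args : car -> seq nat;
  arity : nat;
  size_args : forall e, size (args e) = arity }.

Definition ext (X : env) : env :=
  @Env (X * nat)%type (fun e => orc e.1) (fun e => e.2 :: args e.1)
       (arity X).+1 (fun e => congr1 S (size_args e.1)).

Definition cpt (X : env) (f : X -> nat) : Prop :=
  exists c, forall e, eval (orc e) c (args e) (f e).

Definition cptb (X : env) (b : X -> bool) : Prop :=
  cpt (fun e => nat_of_bool (b e)).

Definition cptq (X : env) (q : X -> baire) : Prop :=
  @cpt (ext X) (fun e => q e.1 e.2).

(* Changes of environment that a program can carry out on the arguments. *)
Definition mor (X Y : env) (h : X -> Y) : Prop :=
  (forall e, orc (h e) = orc e) /\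
  exists cs, forall e,
    List.Forall2 (fun c => eval (orc e) c (args e)) cs (args (h e)).

Lemma cpt_comp (X Y : env) (h : X -> Y) (f : Y -> nat) :
  cpt f -> mor h -> cpt (fun e => f (h e)).
Proof.
move=> [c Hc] [Ho [cs Hcs]]; exists (Comp c cs) => e.
by apply: eval_comp (Hcs e) _; rewrite -Ho; apply: Hc.
Qed.

Lemma mor_id (X : env) : mor (fun e : X => e).
Proof.
split=> //; exists [seq Proj i | i <- iota 0 (arity X)] => e.
rewrite -(size_args e).
suff H s t : List.Forall2 (fun c => eval (orc e) c (s ++ t))
    [seq Proj i | i <- iota (size s) (size t)] t.
  exact: (H [::] (args e)).
elim: t s => [|x t IH] s /=; first by constructor.
constructor.
  have := @eval_proj (orc e) (size s) (s ++ x :: t).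
  rewrite nth_cat ltnn subnn /=; apply.
  by rewrite size_cat /= addnS ltnS leq_addr.
by have := IH (rcons s x); rewrite size_rcons cat_rcons.
Qed.

Lemma mor_pair (X Y : env) (h : X -> Y) (a : X -> nat) :
  mor h -> cpt a -> @mor X (ext Y) (fun e => (h e, a e)).
Proof.
move=> [Ho [cs Hcs]] [c Hc]; split=> [e|]; first exact: Ho.
by exists (c :: cs) => e; constructor; [apply: Hc|apply: Hcs].
Qed.

Lemma mor_fst (X : env) : @mor (ext X) X (fun e => e.1).
Proof.
have [_ [[|c cs] Hcs]] := mor_id (ext X); split=> //.
  have [X0|X0] := pselect (exists e : ext X, True).
    by have [e _] := X0; have := Hcs e => /List.Forall2_length.
  by exists [::] => e; case: X0; exists e.
by exists cs => e; have := Hcs e => /(List.Forall2_cons_iff) [].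
Qed.

Lemma mor_wk (X Y : env) (h : X -> Y) :
  mor h -> @mor (ext X) Y (fun e => h e.1).
Proof.
move=> [Ho [cs Hcs]]; have [_ [ds Hds]] := mor_fst X.
split=> [e|]; first exact: (Ho e.1).
exists [seq Comp c ds | c <- cs] => e.
move: (Hcs e.1); elim: cs (args (h e.1)) {Hcs} => [|c cs IH] l H /=;
  inversion H; subst; constructor; last exact: IH.
exact: eval_comp (Hds e) _.
Qed.

Lemma cpt_wk (X : env) (f : X -> nat) :
  cpt f -> @cpt (ext X) (fun e => f e.1).
Proof. by move=> Hf; apply: cpt_comp Hf (mor_fst X). Qed.

Lemma cpt_var (X : env) : @cpt (ext X) (fun e => e.2).
Proof.
exists (Proj 0) => e.
by apply: (@eval_proj _ 0 (args e)).
Qed.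

Lemma cptb_wk (X : env) (f : X -> bool) :
  cptb f -> @cptb (ext X) (fun e => f e.1).
Proof. exact: cpt_wk. Qed.

Lemma cptq_wk (X : env) (q : X -> baire) :
  cptq q -> @cptq (ext X) (fun e => q e.1).
Proof.
move=> Hq; apply: (cpt_comp (h := fun e : ext (ext X) => (e.1.1, e.2) : ext X) Hq).
by apply: mor_pair; [apply/mor_wk/mor_fst|apply: cpt_var].
Qed.

Lemma cpt_app (X : env) (q : X -> baire) (a : X -> nat) :
  cptq q -> cpt a -> cpt (fun e => q e (a e)).
Proof.
move=> Hq Ha.
exact: (cpt_comp (h := fun e => (e, a e) : ext X) Hq (mor_pair (mor_id X) Ha)).
Qed.

Lemma cptq_orc (X : env) : cptq (fun e : X => orc e).
Proof.
by exists (Comp Query [:: Proj 0]) => e; apply: eval_comp (eval_query _ _ [::]);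
  constructor; [apply: (@eval_proj _ 0 (args e))|constructor].
Qed.

Lemma cpt_const (X : env) (n : nat) : cpt (fun _ : X => n).
Proof.
elim: n => [|n [c Hc]]; first by exists Zero => e; apply: eval_zero.
by exists (Comp Succ [:: c]) => e; apply: eval_comp (eval_succ _ _ [::]);
  constructor; [apply: Hc|constructor].
Qed.

Lemma cpt_succ (X : env) (a : X -> nat) : cpt a -> cpt (fun e => (a e).+1).
Proof.
by move=> [c Hc]; exists (Comp Succ [:: c]) => e; apply: eval_comp (eval_succ _ _ [::]);
  constructor; [apply: Hc|constructor].
Qed.

Lemma cpt_iteri (X : env) (n a : X -> nat) (g : X -> nat -> nat -> nat) :
  cpt n -> cpt a -> @cpt (ext (ext X)) (fun e => g e.1.1 e.2 e.1.2) ->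
  cpt (fun e => iteri (n e) (g e) (a e)).
Proof.
move=> [cn Hn] [ca Ha] [cg Hg]; have [_ [ds Hds]] := mor_id X.
exists (Comp (Prec ca cg) (cn :: ds)) => e.
apply: (@eval_comp _ _ _ _ (n e :: args e)).
  by constructor; [apply: Hn|apply: Hds].
elim: (n e) => [|m IH] /=; first exact/eval_prec0/Ha.
by apply: eval_precS IH _; apply: (Hg (e, _, m)).
Qed.

Lemma cpt_ext (X : env) (f g : X -> nat) : f =1 g -> cpt f -> cpt g.
Proof. by move=> fg [c Hc]; exists c => e; rewrite -fg; apply: Hc. Qed.

Lemma cpt_add (X : env) (a b : X -> nat) :
  cpt a -> cpt b -> cpt (fun e => a e + b e).
Proof.
move=> Ha Hb; apply: (cpt_ext (f := fun e => iteri (b e) (fun _ y => y.+1) (a e))).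
  by move=> e; elim: (b e) => [|n IH] /=; rewrite ?addn0 // addnS IH.
apply: (@cpt_iteri _ _ _ (fun _ _ y => y.+1)) => //.
exact/cpt_succ/cpt_wk/cpt_var.
Qed.

Lemma cpt_mul (X : env) (a b : X -> nat) :
  cpt a -> cpt b -> cpt (fun e => a e * b e).
Proof.
move=> Ha Hb; apply: (cpt_ext (f := fun e => iteri (b e) (fun _ y => a e + y) 0)).
  by move=> e; elim: (b e) => [|n IH] /=; rewrite ?muln0 // mulnS IH.
apply: (@cpt_iteri _ _ _ (fun e _ y => a e + y)) => //; first exact: cpt_const.
apply: cpt_add; last exact/cpt_wk/cpt_var.
exact: cpt_comp Ha (mor_wk (mor_fst X)).
Qed.

Lemma cpt_pred (X : env) (a : X -> nat) : cpt a -> cpt (fun e => (a e).-1).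
Proof.
move=> Ha; apply: (cpt_ext (f := fun e => iteri (a e) (fun i _ => i) 0)).
  by move=> e; case: (a e).
apply: (@cpt_iteri _ _ _ (fun e i _ => i)) => //; first exact: cpt_const.
exact/cpt_var.
Qed.

Lemma cpt_sub (X : env) (a b : X -> nat) :
  cpt a -> cpt b -> cpt (fun e => a e - b e).
Proof.
move=> Ha Hb; apply: (cpt_ext (f := fun e => iteri (b e) (fun _ y => y.-1) (a e))).
  by move=> e; elim: (b e) => [|n IH] /=; rewrite ?subn0 // subnS IH.
apply: (@cpt_iteri _ _ _ (fun _ _ y => y.-1)) => //.
exact/cpt_pred/cpt_wk/cpt_var.
Qed.

Lemma cptb_not (X : env) (a : X -> bool) : cptb a -> cptb (fun e => ~~ a e).
Proof.
move=> Ha; apply: (cpt_ext (f := fun e => 1 - a e)); first by move=> e; case: (a e).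
by apply: cpt_sub => //; apply: cpt_const.
Qed.

Lemma cptb_and (X : env) (a b : X -> bool) :
  cptb a -> cptb b -> cptb (fun e => a e && b e).
Proof.
move=> Ha Hb; apply: (cpt_ext (f := fun e => a e * b e)); last exact: cpt_mul.
by move=> e; case: (a e); case: (b e).
Qed.

Lemma cptb_or (X : env) (a b : X -> bool) :
  cptb a -> cptb b -> cptb (fun e => a e || b e).
Proof.
move=> Ha Hb; apply: (cpt_ext (f := fun e => ~~ (~~ a e && ~~ b e))).
  by move=> e; rewrite negb_and !negbK.
by apply/cptb_not/cptb_and; apply: cptb_not.
Qed.

Lemma cptb_eq0 (X : env) (a : X -> nat) : cpt a -> cptb (fun e => a e == 0).
Proof.
move=> Ha; apply: (cpt_ext (f := fun e => 1 - a e)); first by move=> e; case: (a e).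
by apply: cpt_sub => //; apply: cpt_const.
Qed.

Lemma cptb_leq (X : env) (a b : X -> nat) :
  cpt a -> cpt b -> cptb (fun e => a e <= b e).
Proof. by move=> Ha Hb; apply/cptb_eq0/cpt_sub. Qed.

Lemma cptb_eq (X : env) (a b : X -> nat) :
  cpt a -> cpt b -> cptb (fun e => a e == b e).
Proof.
move=> Ha Hb; apply: (cpt_ext (f := fun e => (a e <= b e) && (b e <= a e))).
  by move=> e; rewrite eqn_leq.
by apply: cptb_and; apply: cptb_leq.
Qed.

Lemma cpt_if (X : env) (b : X -> bool) (x y : X -> nat) :
  cptb b -> cpt x -> cpt y -> cpt (fun e => if b e then x e else y e).
Proof.
move=> Hb Hx Hy; apply: (cpt_ext (f := fun e => b e * x e + (1 - b e) * y e)).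
  by move=> e; case: (b e) => /=; lia.
by apply: cpt_add; apply: cpt_mul => //; apply: cpt_sub => //; apply: cpt_const.
Qed.

Lemma cptb_const (X : env) (b : bool) : cptb (fun _ : X => b).
Proof. exact: cpt_const. Qed.

Lemma cpt_exp (X : env) (a b : X -> nat) :
  cpt a -> cpt b -> cpt (fun e => a e ^ b e).
Proof.
move=> Ha Hb; apply: (cpt_ext (f := fun e => iteri (b e) (fun _ y => a e * y) 1)).
  by move=> e; elim: (b e) => [|n IH] /=; rewrite ?expn0 // expnS IH.
apply: (@cpt_iteri _ _ _ (fun e _ y => a e * y)) => //; first exact: cpt_const.
apply: cpt_mul; last exact/cpt_wk/cpt_var.
exact: cpt_comp Ha (mor_wk (mor_fst X)).
Qed.

Lemma cpt_sum (X : env) (n : X -> nat) (F : X -> nat -> nat) :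
  cpt n -> @cpt (ext X) (fun e => F e.1 e.2) ->
  cpt (fun e => \sum_(0 <= i < n e) F e i).
Proof.
move=> Hn HF.
apply: (cpt_ext (f := fun e => iteri (n e) (fun i y => y + F e i) 0)).
  move=> e; elim: (n e) => [|m IH] /=; first by rewrite big_geq.
  by rewrite big_nat_recr //= IH.
apply: (@cpt_iteri _ _ _ (fun e i y => y + F e i)) => //; first exact: cpt_const.
apply: cpt_add; first exact/cpt_wk/cpt_var.
apply: (cpt_comp (h := fun e : ext (ext X) => (e.1.1, e.2) : ext X) HF).
by apply: mor_pair; [exact/mor_wk/mor_fst|exact: cpt_var].
Qed.

Lemma cpt_ffact (X : env) (a b : X -> nat) :
  cpt a -> cpt b -> cpt (fun e => a e ^_ b e).
Proof.
move=> Ha Hb.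
apply: (cpt_ext (f := fun e => iteri (b e) (fun i y => y * (a e - i)) 1)).
  move=> e; rewrite ffact_prod.
  by elim: (b e) => [|m IH] /=; rewrite ?big_ord0 // big_ord_recr /= IH.
apply: (@cpt_iteri _ _ _ (fun e i y => y * (a e - i))) => //; first exact: cpt_const.
apply: cpt_mul; first exact/cpt_wk/cpt_var.
apply: cpt_sub; last exact: cpt_var.
exact: cpt_comp Ha (mor_wk (mor_fst X)).
Qed.

Definition bexists (n : nat) (P : nat -> bool) := has P (iota 0 n).
Definition bforall (n : nat) (P : nat -> bool) := all P (iota 0 n).
Definition bmin (n : nat) (P : nat -> bool) := find P (iota 0 n).

Lemma bexistsP n (P : nat -> bool) : reflect (exists2 i, i < n & P i) (bexists n P).
Proof.
by apply: (iffP hasP) => -[i]; rewrite ?mem_iota /=; exists i; rewrite ?mem_iota.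
Qed.

Lemma bforallP n (P : nat -> bool) : reflect (forall i, i < n -> P i) (bforall n P).
Proof.
apply: (iffP allP) => H i; last by rewrite mem_iota; apply: H.
by move=> Hi; apply: H; rewrite mem_iota.
Qed.

Lemma bmin_leq n P : bmin n P <= n.
Proof. by rewrite -{2}(size_iota 0 n) find_size. Qed.

Lemma bmin_lt n P : (bmin n P < n) = bexists n P.
Proof. by rewrite /bexists has_find size_iota. Qed.

Lemma bminP n (P : nat -> bool) : bexists n P -> P (bmin n P).
Proof.
move=> H; have := nth_find 0 H; rewrite nth_iota ?add0n //.
by rewrite bmin_lt.
Qed.

Lemma bmin_before n P i : i < bmin n P -> P i = false.
Proof.
move=> H; have := before_find 0 H; rewrite nth_iota //.
exact: leq_trans H (bmin_leq n P).
Qed.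

Lemma bmin_widen m n P : m <= n -> bexists m P -> bmin n P = bmin m P.
Proof.
move=> mn H; rewrite /bmin -(subnKC mn) iotaD find_cat.
by rewrite -/(bexists m P) H.
Qed.

Lemma cptb_bexists (X : env) (n : X -> nat) (P : X -> nat -> bool) :
  cpt n -> @cptb (ext X) (fun e => P e.1 e.2) ->
  cptb (fun e => bexists (n e) (P e)).
Proof.
move=> Hn HP; apply: (cpt_ext (f := fun e => 0 < \sum_(0 <= i < n e) (P e i : nat))).
  move=> e; rewrite /bexists /index_iota subn0; congr nat_of_bool.
  elim: (iota _ _) => [|x s IH]; first by rewrite big_nil.
  by rewrite big_cons /= addn_gt0 IH; case: (P e x).
apply: cptb_leq; first exact: cpt_const.
exact: (cpt_sum (F := fun e i => P e i : nat)).
Qed.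

Lemma cptb_bforall (X : env) (n : X -> nat) (P : X -> nat -> bool) :
  cpt n -> @cptb (ext X) (fun e => P e.1 e.2) ->
  cptb (fun e => bforall (n e) (P e)).
Proof.
move=> Hn HP; apply: (cpt_ext (f := fun e => ~~ bexists (n e) (fun i => ~~ P e i))).
  by move=> e; rewrite -all_predC; congr nat_of_bool; apply: eq_all => x /=; rewrite negbK.
by apply/cptb_not/(cptb_bexists (P := fun e i => ~~ P e i)) => //; apply: cptb_not.
Qed.

Lemma cpt_bmin (X : env) (n : X -> nat) (P : X -> nat -> bool) :
  cpt n -> @cptb (ext X) (fun e => P e.1 e.2) ->
  cpt (fun e => bmin (n e) (P e)).
Proof.
move=> Hn HP.
apply: (cpt_ext (f := fun e => iteri (n e)
   (fun i y => if y < i then y else if P e i then i else i.+1) 0)).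
  move=> e; elim: (n e) => [|m IH] //=; rewrite IH.
  rewrite /bmin -[in RHS]addn1 iotaD find_cat /= add0n size_iota.
  rewrite -/(bmin m (P e)) -/(bexists m (P e)) bmin_lt; case: ifP => // _.
  by case: (P e m); rewrite /= ?addn0 ?addn1.
apply: (@cpt_iteri _ _ _ (fun e i y => if y < i then y else if P e i then i else i.+1)) => //;
  first exact: cpt_const.
apply: cpt_if; [|exact/cpt_wk/cpt_var|apply: cpt_if].
- by apply: cptb_leq; [exact/cpt_succ/cpt_wk/cpt_var|exact: cpt_var].
- apply: (cpt_comp (h := fun e : ext (ext X) => (e.1.1, e.2) : ext X) HP).
  by apply: mor_pair; [exact/mor_wk/mor_fst|exact: cpt_var].
- exact: cpt_var.
- exact/cpt_succ/cpt_var.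
Qed.

Lemma cpt_divn (X : env) (a b : X -> nat) :
  cpt a -> cpt b -> cpt (fun e => a e %/ b e).
Proof.
move=> Ha Hb; apply: (cpt_ext (f := fun e => if b e == 0 then 0 else
    bmin (a e) (fun i => a e < i.+1 * b e))).
  move=> e; case: eqP => [->|/eqP b0]; first by rewrite divn0.
  have b_gt0 : 0 < b e by rewrite lt0n.
  have Q i : (a e < i.+1 * b e) = (a e %/ b e <= i) by rewrite -ltn_divLR.
  have [[i ai Hi]|N] := bexistsP (a e) (fun i => a e < i.+1 * b e).
    have Hex : bexists (a e) (fun i => a e < i.+1 * b e) by apply/bexistsP; exists i.
    apply/eqP; rewrite eqn_leq -Q (bminP Hex) andbT leqNgt; apply/negP => /bmin_before.
    by rewrite Q leqnn.
  have -> : bmin (a e) (fun i => a e < i.+1 * b e) = a e.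
    apply/eqP; rewrite eqn_leq bmin_leq leqNgt bmin_lt; apply/negP => /bexistsP[i ? ?].
    by apply: N; exists i.
  apply/eqP; rewrite eqn_leq leq_div andbT leqNgt; apply/negP => lt.
  by apply: N; exists (a e %/ b e); rewrite // Q.
apply: cpt_if; [exact: cptb_eq0|exact: cpt_const|].
apply: (cpt_bmin (P := fun e i => a e < i.+1 * b e)) => //.
apply: cptb_leq; first exact/cpt_succ/cpt_wk.
by apply: cpt_mul; [exact/cpt_succ/cpt_var|exact: cpt_wk].
Qed.

Lemma cptb_odd (X : env) (a : X -> nat) : cpt a -> cptb (fun e => odd (a e)).
Proof.
move=> Ha; apply: (cpt_ext (f := fun e => a e - a e %/ 2 * 2)).
  by move=> e; rewrite divn2 muln2 -{1}(odd_double_half (a e)) addnK.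
by apply: cpt_sub => //; apply: cpt_mul; [apply: cpt_divn|]; rewrite //; apply: cpt_const.
Qed.

Definition cpair x y := Cantor.to_nat (x, y).
Definition cfst n := (Cantor.of_nat n).1.
Definition csnd n := (Cantor.of_nat n).2.

Lemma cpairK1 x y : cfst (cpair x y) = x.
Proof. by rewrite /cfst Cantor.cancel_of_to. Qed.

Lemma cpairK2 x y : csnd (cpair x y) = y.
Proof. by rewrite /csnd Cantor.cancel_of_to. Qed.

Lemma cpair_eta n : cpair (cfst n) (csnd n) = n.
Proof. by rewrite /cpair /cfst /csnd -surjective_pairing Cantor.cancel_to_of. Qed.

Lemma cpairE x y : cpair x y = y + (y + x) * (y + x).+1 %/ 2.
Proof.
have := Cantor.to_nat_spec x y; rewrite -/(cpair x y) => H.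
have {}H : cpair x y * 2 = y * 2 + (y + x) * (y + x).+1 by lia.
by apply/eqP; rewrite -(eqn_pmul2r (m := 2)) // H [X in _ == X]mulnDl divnK // dvdn2 oddM /= andbN.
Qed.

Lemma cpair_ge x y : (x <= cpair x y) /\ (y <= cpair x y).
Proof.
have H := Cantor.to_nat_spec x y; rewrite -/(cpair x y) in H.
by split; nia.
Qed.

Lemma ltn_cpair x y x' y' : x < x' -> y < y' -> cpair x y < cpair x' y'.
Proof.
have H := Cantor.to_nat_spec x y; rewrite -/(cpair x y) in H.
have H' := Cantor.to_nat_spec x' y'; rewrite -/(cpair x' y') in H'.
by move=> ? ?; nia.
Qed.

Lemma cpt_cpair (X : env) (a b : X -> nat) :
  cpt a -> cpt b -> cpt (fun e => cpair (a e) (b e)).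
Proof.
move=> Ha Hb; apply: (cpt_ext (f := fun e => b e + (b e + a e) * (b e + a e).+1 %/ 2)).
  by move=> e; rewrite cpairE.
apply: cpt_add => //; apply: cpt_divn; last exact: cpt_const.
by apply: cpt_mul; last apply: cpt_succ; apply: cpt_add.
Qed.

Lemma cpt_cfst (X : env) (a : X -> nat) : cpt a -> cpt (fun e => cfst (a e)).
Proof.
move=> Ha; apply: (cpt_ext (f := fun e => bmin (a e).+1 (fun x =>
    bexists (a e).+1 (fun y => cpair x y == a e)))).
  move=> e; set P := fun x => bexists _ _.
  have PE : P =1 (fun x => x == cfst (a e)).
    move=> x; apply/bexistsP/eqP => [[y _ /eqP <-]|->]; first by rewrite cpairK1.
    exists (csnd (a e)); last by rewrite cpair_eta.
    by rewrite ltnS -{2}(cpair_eta (a e)); case: (cpair_ge (cfst (a e)) (csnd (a e))).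
  apply/eqP; rewrite -PE; apply: bminP; apply/bexistsP; exists (cfst (a e)); last by rewrite PE.
  by rewrite ltnS -{2}(cpair_eta (a e)); case: (cpair_ge (cfst (a e)) (csnd (a e))).
apply: (cpt_bmin (P := fun e x => bexists (a e).+1 (fun y => cpair x y == a e))).
  exact: cpt_succ.
apply: (@cptb_bexists (ext X) (fun e => (a e.1).+1) (fun e y => cpair e.2 y == a e.1)).
  exact/cpt_succ/cpt_wk.
apply: cptb_eq; last exact: cpt_comp Ha (mor_wk (mor_fst X)).
by apply: cpt_cpair; [exact/cpt_wk/cpt_var|exact: cpt_var].
Qed.

Lemma cpt_csnd (X : env) (a : X -> nat) : cpt a -> cpt (fun e => csnd (a e)).
Proof.
move=> Ha; apply: (cpt_ext (f := fun e => bmin (a e) (fun y => cpair (cfst (a e)) y == a e))).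
  move=> e; set P := fun y => _.
  have PE : P =1 (fun x => x == csnd (a e)).
    by move=> x; apply/eqP/eqP => [<-|->]; rewrite ?cpairK2 ?cpair_eta.
  have Hle : csnd (a e) <= a e.
    by rewrite -{2}(cpair_eta (a e)); case: (cpair_ge (cfst (a e)) (csnd (a e))).
  move: Hle; rewrite leq_eqVlt => /predU1P[E|L].
    apply/eqP; rewrite eqn_leq {1}E bmin_leq /= leqNgt; apply/negP => L.
    move: (L); rewrite E bmin_lt => /bminP; rewrite PE => /eqP E'.
    by rewrite E' ltnn in L.
  by apply/eqP; rewrite -PE; apply: bminP; apply/bexistsP; exists (csnd (a e)); rewrite ?PE.
apply: (cpt_bmin (P := fun e y => cpair (cfst (a e)) y == a e)) => //.
apply: cptb_eq; last exact: cpt_wk.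
by apply: cpt_cpair; [exact/cpt_cfst/cpt_wk|exact: cpt_var].
Qed.

Lemma sliceE p i k : slice p i k = p (cpair i k).+1.
Proof. by []. Qed.

Lemma cptq_slice (X : env) (q : X -> baire) (i : X -> nat) :
  cptq q -> cpt i -> cptq (fun e => slice (q e) (i e)).
Proof.
move=> Hq Hi; apply: (@cpt_app (ext X) (fun e => q e.1)); first exact: cptq_wk.
by apply/cpt_succ/cpt_cpair; [exact: cpt_wk|exact: cpt_var].
Qed.

Ltac cpt_user := fail.

Ltac cpt_auto :=
  lazymatch goal with
  | |- cpt (fun e => nat_of_bool (@?b e)) => change (cptb b); cpt_auto
  | |- cpt (fun e => addn (@?a e) (@?b e)) => apply (@cpt_add _ a b); cpt_auto
  | |- cpt (fun e => subn (@?a e) (@?b e)) => apply (@cpt_sub _ a b); cpt_auto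
  | |- cpt (fun e => muln (@?a e) (@?b e)) => apply (@cpt_mul _ a b); cpt_auto
  | |- cpt (fun e => expn (@?a e) (@?b e)) => apply (@cpt_exp _ a b); cpt_auto
  | |- cpt (fun e => divn (@?a e) (@?b e)) => apply (@cpt_divn _ a b); cpt_auto
  | |- cpt (fun e => falling_factorial (@?a e) (@?b e)) =>
      apply (@cpt_ffact _ a b); cpt_auto
  | |- cpt (fun e => predn (@?a e)) => apply (@cpt_pred _ a); cpt_auto
  | |- cpt (fun e => cpair (@?a e) (@?b e)) => apply (@cpt_cpair _ a b); cpt_auto
  | |- cpt (fun e => cfst (@?a e)) => apply (@cpt_cfst _ a); cpt_auto
  | |- cpt (fun e => csnd (@?a e)) => apply (@cpt_csnd _ a); cpt_auto
  | |- cpt (fun e => bmin (@?n e) (@?P e)) => apply (@cpt_bmin _ n P); cpt_auto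
  | |- cpt (fun e => bigop _ _ _) => apply cpt_sum; cpt_auto
  | |- cptb (fun e => andb (@?a e) (@?b e)) => apply (@cptb_and _ a b); cpt_auto
  | |- cptb (fun e => orb (@?a e) (@?b e)) => apply (@cptb_or _ a b); cpt_auto
  | |- cptb (fun e => negb (@?a e)) => apply (@cptb_not _ a); cpt_auto
  | |- cptb (fun e => odd (@?a e)) => apply (@cptb_odd _ a); cpt_auto
  | |- cptb (fun e => leq (@?a e) (@?b e)) => apply (@cptb_leq _ a b); cpt_auto
  | |- cptb (fun e => eq_op (@?a e) (@?b e)) => apply (@cptb_eq _ a b); cpt_auto
  | |- cptb (fun e => bexists (@?n e) (@?P e)) => apply (@cptb_bexists _ n P); cpt_auto
  | |- cptb (fun e => bforall (@?n e) (@?P e)) => apply (@cptb_bforall _ n P); cpt_auto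
  | |- cpt (fun e => slice (@?q e) (@?i e) (@?k e)) =>
      apply (@cpt_app _ (fun e => slice (q e) (i e)) k); cpt_auto
  | |- cptq (fun e => slice (@?q e) (@?i e)) => apply (@cptq_slice _ q i); cpt_auto
  | |- cptb _ => first
    [ assumption | apply cptb_const | cpt_user | apply cptb_wk; cpt_auto
    | match goal with H : cptb ?f |- @cptb (ext ?Y) _ =>
        apply (@cptb_wk Y (fun e => f e.1)); cpt_auto end
    | idtac ]
  | |- cptq _ => first
    [ assumption | apply cptq_orc | cpt_user | apply cptq_wk; cpt_auto
    | match goal with H : cptq ?f |- @cptq (ext ?Y) _ =>
        apply (@cptq_wk Y (fun e => f e.1)); cpt_auto end
    | idtac ]
  | |- cpt _ => first
    [ assumption | apply cpt_const | apply cpt_var | cpt_user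
    | apply cpt_if; cpt_auto | apply cpt_succ; cpt_auto | apply cpt_wk; cpt_auto
    | match goal with H : cpt ?f |- @cpt (ext ?Y) _ =>
        apply (@cpt_wk Y (fun e => f e.1)); cpt_auto end
    | match goal with |- @cpt (ext ?Y) _ =>
        first [ apply (@cpt_wk Y (fun e => e.2)) | apply (@cpt_wk Y (fun e => e.1.2)) ];
        cpt_auto end
    | match goal with H : cptq ?q |- @cpt ?Y _ => first
        [ apply (@cpt_app Y q) | apply (@cpt_app Y (fun e => q e.1))
        | apply (@cpt_app Y (fun e => q e.1.1)) ]
      end; cpt_auto
    | idtac ]
  end.

(* The rational coded by [c] is [(rnum true c - rnum false c) / rden c]. *)
Definition rnum (s : bool) (c : nat) : nat :=
  if s then cfst (cfst c) else csnd (cfst c).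
Definition rden (c : nat) : nat := (csnd c).+1.
Definition mkrat (a b d : nat) : nat := cpair (cpair a b) d.
Definition rlt (c d : nat) : bool :=
  rnum true c * rden d + rnum false d * rden c <
  rnum true d * rden c + rnum false c * rden d.

Lemma cpt_rnum (X : env) (s : X -> bool) (a : X -> nat) :
  cptb s -> cpt a -> cpt (fun e => rnum (s e) (a e)).
Proof. by move=> Hs Ha; rewrite /rnum; cpt_auto. Qed.

Lemma cpt_rden (X : env) (a : X -> nat) : cpt a -> cpt (fun e => rden (a e)).
Proof. by move=> Ha; rewrite /rden; cpt_auto. Qed.

Lemma cpt_mkrat (X : env) (a b d : X -> nat) :
  cpt a -> cpt b -> cpt d -> cpt (fun e => mkrat (a e) (b e) (d e)).
Proof. by move=> *; rewrite /mkrat; cpt_auto. Qed.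

Ltac cpt_user ::= lazymatch goal with
  | |- cpt (fun e => rnum (@?s e) (@?a e)) => apply (@cpt_rnum _ s a); cpt_auto
  | |- cpt (fun e => rden (@?a e)) => apply (@cpt_rden _ a); cpt_auto
  | |- cpt (fun e => mkrat (@?a e) (@?b e) (@?d e)) => apply (@cpt_mkrat _ a b d); cpt_auto
  end.

Lemma cptb_rlt (X : env) (a b : X -> nat) :
  cpt a -> cpt b -> cptb (fun e => rlt (a e) (b e)).
Proof. by move=> *; rewrite /rlt; cpt_auto. Qed.

(* [2 ^ m] times the positive ([s = true]) or negative part of the [m]-th
   approximation of the [i]-th coefficient, rounded down. *)
Definition scoef (s : bool) (q : baire) (i m : nat) : nat :=
  if i <= q 0 then rnum s (slice q i m) * 2 ^ m %/ rden (slice q i m) else 0.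

(* [hnum true q k m j - hnum false q k m j] approximates
   [2 ^ (m * (N + 1)) * P^`(k).[j / 2 ^ m]], where [N = q 0] bounds the degree. *)
Definition hnum (s : bool) (q : baire) (k m j : nat) : nat :=
  \sum_(0 <= i < (q 0).+1)
    scoef s q (k + i) m * (k + i) ^_ k * (j ^ i * (2 ^ m) ^ (q 0 - i)).

Definition cbound (q : baire) (i : nat) : nat :=
  if i <= q 0 then rnum true (slice q i 0) + rnum false (slice q i 0) + 1 else 0.

(* Bounds, up to the factor [2 ^ (m * N)], the error made by [hnum] on the whole
   cell to the right of [j / 2 ^ m]: [2] comes from approximating and rounding
   the coefficient, [i * cbound] from moving the point by [2 ^ - m]. *)
Definition errb (q : baire) (k : nat) : nat :=
  \sum_(0 <= i < (q 0).+1) (k + i) ^_ k * (2 + i * cbound q (k + i)).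

Definition cert (s : bool) (q : baire) (k m j : nat) : bool :=
  hnum (~~ s) q k m j + (2 ^ m) ^ q 0 * errb q k < hnum s q k m j.

(* Bit [k] of [sg] prescribes the sign of the derivative of order [k.+1]. *)
Definition dead (q : baire) (sg m j : nat) : bool :=
  [|| cert true q 0 m j, cert false q 0 m j |
    bexists (q 0) (fun k => cert (~~ odd (sg %/ 2 ^ k)) q k.+1 m j)].

(* Level [0] never counts, so that a last level with an alive cell exists even
   if everything dies. *)
Definition alive (D : nat -> nat -> bool) (m j : nat) : bool :=
  bforall m (fun l => ~~ D l.+1 (j %/ 2 ^ (m - l.+1))).

Definition emptied (D : nat -> nat -> bool) (m : nat) : bool :=
  ~~ bexists (2 ^ m) (alive D m).

(* The intervals for [j = 0] and [j = 1] leave only the point coded by [c]. *)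
Definition freeze (c j : nat) : nat :=
  if j == 0 then cpair (mkrat 0 1 0) c else cpair c (mkrat 2 0 0).

Definition last_level (D : nat -> nat -> bool) (m : nat) : nat :=
  (bmin m.+1 (emptied D)).-1.

(* The midpoint of an alive cell of level [l] lies in no interval emitted up to
   that level. *)
Definition last_point (D : nat -> nat -> bool) (l : nat) : nat :=
  mkrat (2 * bmin (2 ^ l) (alive D l)).+1 0 (2 ^ l.+1).-1.

Definition emit (D : nat -> nat -> bool) (m j : nat) : nat :=
  if emptied D m then freeze (last_point D (last_level D m)) j
  else if [&& j <= 2 ^ m, (j == 0) || ~~ alive D m j.-1
                        & (j == 2 ^ m) || ~~ alive D m j]
  then cpair (mkrat j 1 (2 ^ m).-1) (mkrat j.+1 0 (2 ^ m).-1) else 0.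

Definition emit2 (l r : nat -> bool) (m j : nat) : nat :=
  if l m || r m then
    freeze (if r (bmin m.+1 (fun i => l i || r i)) then mkrat 0 0 0
            else mkrat 1 0 0) j
  else 0.

Definition low (q : baire) (sg m : nat) : bool :=
  bforall sg (fun t => emptied (dead q t) m).

Definition inst (q : baire) (b sg m j : nat) : nat :=
  if b == 0 then emit (dead q sg) m j
  else emit2 (low q sg) (emptied (dead q sg)) m j.

Definition nsigns (p : baire) : nat := 2 ^ \sum_(0 <= i < p 0) slice p i 0.

(* Slot [<<i, sg>, b>] holds, for the [i]-th polynomial, the instance searching a
   root with signs [sg] if [b = 0], and the one testing [sg] otherwise; slots that
   are never read hold a valid instance as well. *)
Definition to_choice (p : baire) (n : nat) : nat :=
  if n == 0 then cpair (cpair (p 0) (nsigns p)) 2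
  else if cfst (cfst (cfst n.-1)) < p 0
  then inst (slice p (cfst (cfst (cfst n.-1)))) (csnd (cfst n.-1))
    (csnd (cfst (cfst n.-1))) (cfst (csnd n.-1)) (csnd (csnd n.-1))
  else 0.

Definition answer (r : baire) (i sg b : nat) : baire :=
  slice r (cpair (cpair i sg) b).

Definition selected (p r : baire) (i : nat) : nat :=
  (nsigns p).-1 -
  bmin (nsigns p)
    (fun d => rlt (mkrat 1 0 1) (answer r i ((nsigns p).-1 - d) 1 2)).

Definition of_choice (p r : baire) (n : nat) : nat :=
  if n == 0 then p 0
  else answer r (cfst n.-1) (selected p r (cfst n.-1)) 0 (csnd n.-1).

Lemma cpt_scoef (X : env) (s : X -> bool) (q : X -> baire) (i m : X -> nat) :
  cptb s -> cptq q -> cpt i -> cpt m ->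
  cpt (fun e => scoef (s e) (q e) (i e) (m e)).
Proof. by move=> *; rewrite /scoef; cpt_auto. Qed.

Ltac cpt_user ::= lazymatch goal with
  | |- cpt (fun e => rnum (@?s e) (@?a e)) => apply (@cpt_rnum _ s a); cpt_auto
  | |- cpt (fun e => rden (@?a e)) => apply (@cpt_rden _ a); cpt_auto
  | |- cpt (fun e => mkrat (@?a e) (@?b e) (@?d e)) => apply (@cpt_mkrat _ a b d); cpt_auto
  | |- cptb (fun e => rlt (@?a e) (@?b e)) => apply (@cptb_rlt _ a b); cpt_auto
  | |- cpt (fun e => scoef (@?s e) (@?q e) (@?i e) (@?m e)) =>
      apply (@cpt_scoef _ s q i m); cpt_auto
  end.

Lemma cpt_hnum (X : env) (s : X -> bool) (q : X -> baire) (k m j : X -> nat) :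
  cptb s -> cptq q -> cpt k -> cpt m -> cpt j ->
  cpt (fun e => hnum (s e) (q e) (k e) (m e) (j e)).
Proof. by move=> *; rewrite /hnum; cpt_auto. Qed.

Lemma cpt_errb (X : env) (q : X -> baire) (k : X -> nat) :
  cptq q -> cpt k -> cpt (fun e => errb (q e) (k e)).
Proof. by move=> *; rewrite /errb /cbound; cpt_auto. Qed.

Lemma cptb_dead (X : env) (q : X -> baire) (sg m j : X -> nat) :
  cptq q -> cpt sg -> cpt m -> cpt j ->
  cptb (fun e => dead (q e) (sg e) (m e) (j e)).
Proof.
have Hcert (Y : env) (s : Y -> bool) (q' : Y -> baire) (k m' j' : Y -> nat) :
    cptb s -> cptq q' -> cpt k -> cpt m' -> cpt j' ->
    cptb (fun e => cert (s e) (q' e) (k e) (m' e) (j' e)).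
  move=> *; rewrite /cert; apply: cptb_leq; last exact: cpt_hnum.
  apply/cpt_succ/cpt_add; first by apply: cpt_hnum => //; apply: cptb_not.
  by apply: cpt_mul; [cpt_auto|apply: cpt_errb].
by move=> *; rewrite /dead; cpt_auto; apply: Hcert; cpt_auto.
Qed.

Ltac cpt_user ::= lazymatch goal with
  | |- cpt (fun e => mkrat (@?a e) (@?b e) (@?d e)) => apply (@cpt_mkrat _ a b d); cpt_auto
  | |- cptb (fun e => rlt (@?a e) (@?b e)) => apply (@cptb_rlt _ a b); cpt_auto
  | |- cptb (fun e => dead (@?q e) (@?s e) (@?m e) (@?j e)) =>
      apply (@cptb_dead _ q s m j); cpt_auto
  end.

Lemma cptb_alive (X : env) (q : X -> baire) (sg m j : X -> nat) :
  cptq q -> cpt sg -> cpt m -> cpt j ->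
  cptb (fun e => alive (dead (q e) (sg e)) (m e) (j e)).
Proof. by move=> *; rewrite /alive; cpt_auto. Qed.

Ltac cpt_user ::= lazymatch goal with
  | |- cpt (fun e => mkrat (@?a e) (@?b e) (@?d e)) => apply (@cpt_mkrat _ a b d); cpt_auto
  | |- cptb (fun e => rlt (@?a e) (@?b e)) => apply (@cptb_rlt _ a b); cpt_auto
  | |- cptb (fun e => alive (dead (@?q e) (@?s e)) (@?m e) (@?j e)) =>
      apply (@cptb_alive _ q s m j); cpt_auto
  end.

Lemma cptb_emptied (X : env) (q : X -> baire) (sg m : X -> nat) :
  cptq q -> cpt sg -> cpt m -> cptb (fun e => emptied (dead (q e) (sg e)) (m e)).
Proof. by move=> *; rewrite /emptied; cpt_auto. Qed.

Ltac cpt_user ::= lazymatch goal with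
  | |- cpt (fun e => mkrat (@?a e) (@?b e) (@?d e)) => apply (@cpt_mkrat _ a b d); cpt_auto
  | |- cptb (fun e => rlt (@?a e) (@?b e)) => apply (@cptb_rlt _ a b); cpt_auto
  | |- cptb (fun e => alive (dead (@?q e) (@?s e)) (@?m e) (@?j e)) =>
      apply (@cptb_alive _ q s m j); cpt_auto
  | |- cptb (fun e => emptied (dead (@?q e) (@?s e)) (@?m e)) =>
      apply (@cptb_emptied _ q s m); cpt_auto
  end.

Lemma cpt_inst (X : env) (q : X -> baire) (b sg m j : X -> nat) :
  cptq q -> cpt b -> cpt sg -> cpt m -> cpt j ->
  cpt (fun e => inst (q e) (b e) (sg e) (m e) (j e)).
Proof.
by move=> *; rewrite /inst /emit /emit2 /low /freeze /last_point /last_level; cpt_auto.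
Qed.

Lemma cpt_nsigns (X : env) (q : X -> baire) :
  cptq q -> cpt (fun e => nsigns (q e)).
Proof. by move=> *; rewrite /nsigns; cpt_auto. Qed.

Ltac cpt_user ::= lazymatch goal with
  | |- cpt (fun e => mkrat (@?a e) (@?b e) (@?d e)) => apply (@cpt_mkrat _ a b d); cpt_auto
  | |- cptb (fun e => rlt (@?a e) (@?b e)) => apply (@cptb_rlt _ a b); cpt_auto
  | |- cpt (fun e => inst (@?q e) (@?b e) (@?s e) (@?m e) (@?j e)) =>
      apply (@cpt_inst _ q b s m j); cpt_auto
  | |- cpt (fun e => nsigns (@?q e)) => apply (@cpt_nsigns _ q); cpt_auto
  end.

Lemma cpt_to_choice (X : env) (q : X -> baire) (n : X -> nat) :
  cptq q -> cpt n -> cpt (fun e => to_choice (q e) (n e)).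
Proof. by move=> *; rewrite /to_choice; cpt_auto. Qed.

Lemma cpt_of_choice (X : env) (q r : X -> baire) (n : X -> nat) :
  cptq q -> cptq r -> cpt n -> cpt (fun e => of_choice (q e) (r e) (n e)).
Proof. by move=> *; rewrite /of_choice /selected /answer; cpt_auto. Qed.

Definition oracle_env : env :=
  @Env baire id (fun _ => [::]) 0 (fun _ => erefl).

Lemma cptq_computable (f : baire -> baire) :
  @cptq oracle_env f -> computable (fun p => Some (f p)).
Proof. by move=> [c Hc]; exists c => p _ [<-] n; apply: (Hc (p, n)). Qed.

Definition search (ok : baire -> nat -> nat -> bool)
    (out : baire -> nat -> nat -> nat) : pmap_baire :=
  fun p => if pselect (forall n, exists m, ok p n m) is left H
           then Some (fun n => out p n (ex_minn (H n))) else None.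

Lemma search_computable ok out :
  @cptb (ext (ext oracle_env)) (fun e => ok e.1.1 e.1.2 e.2) ->
  @cpt (ext (ext oracle_env)) (fun e => out e.1.1 e.1.2 e.2) ->
  computable (search ok out).
Proof.
move=> /cptb_not[c Hc] [d Hd]; exists (Comp d [:: Mu c; Proj 0]) => p q.
rewrite /search; case: pselect => // H [<-] n.
apply: (@eval_comp _ _ _ _ [:: ex_minn (H n); n]); last first.
  exact: (Hd (p, n, ex_minn (H n))).
constructor; last by constructor; [apply: (@eval_proj p 0 [:: n])|constructor].
case: ex_minnP => m okm Hmin; apply: (@eval_mu _ _ _ _ (fun _ => 0)).
  move=> i im; have := Hc (p, n, i); rewrite /=.
  by case: (boolP (ok p n i)) => // /Hmin; rewrite leqNgt im.
by have := Hc (p, n, m); rewrite /= okm.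
Qed.

Definition evens (p : baire) : baire := fun n => p n.*2.
Definition odds (p : baire) : baire := fun n => p n.*2.+1.

Lemma evens_pair p r : evens (pair_baire p r) = p.
Proof. by apply/funext => n; rewrite /evens /pair_baire odd_double doubleK. Qed.

Lemma odds_pair p r : odds (pair_baire p r) = r.
Proof.
by apply/funext => n; rewrite /odds /pair_baire /= odd_double /= uphalf_double.
Qed.

Lemma cptq_evens : @cptq oracle_env evens.
Proof.
apply: (@cpt_app (ext oracle_env) (fun e => e.1) (fun e => e.2.*2)).
  exact: (@cptq_wk oracle_env id (cptq_orc oracle_env)).
by apply: (cpt_ext (f := fun e : ext oracle_env => e.2 * 2)) => [e|]; [rewrite muln2|cpt_auto].
Qed.

Lemma cptq_odds : @cptq oracle_env odds.
Proof.
apply: (@cpt_app (ext oracle_env) (fun e => e.1) (fun e => e.2.*2.+1)).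
  exact: (@cptq_wk oracle_env id (cptq_orc oracle_env)).
apply/cpt_succ.
by apply: (cpt_ext (f := fun e : ext oracle_env => e.2 * 2)) => [e|]; [rewrite muln2|cpt_auto].
Qed.

Definition hit (q : baire) (n : nat) : bool :=
  [&& rlt (cfst (q n)) (csnd (q n)), rlt (cfst (q n)) (mkrat 1 0 0)
    & rlt (mkrat 0 0 0) (csnd (q n))].

Definition covered (q : baire) (m j : nat) : bool :=
  bexists m (fun n => rlt (cfst (q n)) (mkrat j 0 m.-1) &&
                  rlt (mkrat j.+1 0 m.-1) (csnd (q n))).

Definition first_uncovered (q : baire) (m : nat) : nat :=
  bmin m (fun j => ~~ covered q m j).

(* The uncovered cells of mesh [1 / m] span less than [2 ^ - k]. *)
Definition sharp (q : baire) (k m : nat) : bool :=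
  (0 < m) && bforall m (fun j =>
    covered q m j || ((j.+1 - first_uncovered q m) * 2 ^ k < m)).

Definition first_hit (q : baire) (k : nat) : nat := bmin k.+1 (hit q).

Definition slope (q : baire) (k : nat) : nat :=
  if bexists k.+1 (hit q) then mkrat 1 0 (2 ^ first_hit q k).-1 else mkrat 0 0 0.

Definition intercept (q : baire) (k m : nat) : nat :=
  if bexists k.+1 (hit q)
  then mkrat 0 (first_uncovered q m) (2 ^ first_hit q k * m).-1
  else mkrat 0 0 0.

(* The search is only needed once an interval has been hit, and would diverge
   on an instance that is the full interval. *)
Definition linear_ok (p : baire) (n m : nat) : bool :=
  ~~ ((cfst n.-1 < p 0) &&
      bexists (csnd (csnd n.-1).-1).+1 (hit (slice p (cfst n.-1)))) ||
  sharp (slice p (cfst n.-1)) (csnd (csnd n.-1).-1) m.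

Definition linear_out (p : baire) (n m : nat) : nat :=
  if n == 0 then p 0
  else if csnd n.-1 == 0 then 1
  else if cfst (csnd n.-1).-1 == 0
  then intercept (slice p (cfst n.-1)) (csnd (csnd n.-1).-1) m
  else slope (slice p (cfst n.-1)) (csnd (csnd n.-1).-1).

Ltac cpt_user ::= lazymatch goal with
  | |- cpt (fun e => mkrat (@?a e) (@?b e) (@?d e)) => apply (@cpt_mkrat _ a b d); cpt_auto
  | |- cptb (fun e => rlt (@?a e) (@?b e)) => apply (@cptb_rlt _ a b); cpt_auto
  end.

Lemma cptb_hit (X : env) (q : X -> baire) (n : X -> nat) :
  cptq q -> cpt n -> cptb (fun e => hit (q e) (n e)).
Proof. by move=> *; rewrite /hit; cpt_auto. Qed.

Lemma cptb_covered (X : env) (q : X -> baire) (m j : X -> nat) :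
  cptq q -> cpt m -> cpt j -> cptb (fun e => covered (q e) (m e) (j e)).
Proof. by move=> *; rewrite /covered; cpt_auto. Qed.

Ltac cpt_user ::= lazymatch goal with
  | |- cpt (fun e => mkrat (@?a e) (@?b e) (@?d e)) => apply (@cpt_mkrat _ a b d); cpt_auto
  | |- cptb (fun e => hit (@?q e) (@?n e)) => apply (@cptb_hit _ q n); cpt_auto
  | |- cptb (fun e => covered (@?q e) (@?m e) (@?j e)) =>
      apply (@cptb_covered _ q m j); cpt_auto
  end.

Lemma cptb_sharp (X : env) (q : X -> baire) (k m : X -> nat) :
  cptq q -> cpt k -> cpt m -> cptb (fun e => sharp (q e) (k e) (m e)).
Proof. by move=> *; rewrite /sharp /first_uncovered; cpt_auto. Qed.

Lemma cpt_slope (X : env) (q : X -> baire) (k : X -> nat) :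
  cptq q -> cpt k -> cpt (fun e => slope (q e) (k e)).
Proof. by move=> *; rewrite /slope /first_hit; cpt_auto. Qed.

Lemma cpt_intercept (X : env) (q : X -> baire) (k m : X -> nat) :
  cptq q -> cpt k -> cpt m -> cpt (fun e => intercept (q e) (k e) (m e)).
Proof. by move=> *; rewrite /intercept /first_hit /first_uncovered; cpt_auto. Qed.

Ltac cpt_user ::= lazymatch goal with
  | |- cptb (fun e => hit (@?q e) (@?n e)) => apply (@cptb_hit _ q n); cpt_auto
  | |- cptb (fun e => sharp (@?q e) (@?k e) (@?m e)) =>
      apply (@cptb_sharp _ q k m); cpt_auto
  | |- cpt (fun e => slope (@?q e) (@?k e)) => apply (@cpt_slope _ q k); cpt_auto
  | |- cpt (fun e => intercept (@?q e) (@?k e) (@?m e)) =>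
      apply (@cpt_intercept _ q k m); cpt_auto
  end.

Lemma linear_computable : computable (search linear_ok linear_out).
Proof.
have Hp : @cptq (ext (ext oracle_env)) (fun e => e.1.1).
  apply: (@cptq_wk (ext oracle_env) (fun e => e.1)).
  exact: (@cptq_wk oracle_env id (cptq_orc oracle_env)).
apply: search_computable.
  by rewrite /linear_ok; cpt_auto.
by rewrite /linear_out; cpt_auto.
Qed.

Lemma to_choice_computable : computable (fun p => Some (to_choice p)).
Proof.
apply/cptq_computable/(@cpt_to_choice (ext oracle_env) (fun e => e.1)).
  exact: (@cptq_wk oracle_env id (cptq_orc oracle_env)).
exact: cpt_var.
Qed.

Lemma of_choice_computable :
  computable (fun p => Some (of_choice (evens p) (odds p))).
Proof.
apply: (@cptq_computable (fun p => of_choice (evens p) (odds p))).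
apply: (@cpt_of_choice (ext oracle_env) (fun e => evens e.1) (fun e => odds e.1)).
- exact: (@cptq_wk oracle_env evens cptq_evens).
- exact: (@cptq_wk oracle_env odds cptq_odds).
- exact: cpt_var.
Qed.

Lemma odds_computable : computable (fun p => Some (odds p)).
Proof. exact/cptq_computable/cptq_odds. Qed.

Import Order.TTheory GRing.Theory Num.Theory.
Import numFieldNormedType.Exports.
Local Open Scope classical_set_scope.
Local Open Scope ring_scope.

(** * Rational codes and grids *)

Section Rationals.
Variable R : realType.
Implicit Types (x y : R) (c d : nat).

Definition qv c : R := ratr (rat_of_code c).

Lemma rden_gt0 c : 0 < (rden c)%:R :> R.
Proof. by rewrite ltr0n. Qed.

Lemma qvE c : qv c = ((rnum true c)%:R - (rnum false c)%:R) / (rden c)%:R.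
Proof.
rewrite /qv /rat_of_code /rnum /rden /cfst /csnd.
case: (Cantor.of_nat c) => n d /=; case: (Cantor.of_nat n) => a b /=.
by rewrite fmorph_div rmorphB /= !ratr_nat.
Qed.

Lemma rltE c d : rlt c d = (qv c < qv d).
Proof.
rewrite !qvE ltr_pdivrMr ?rden_gt0// mulrAC ltr_pdivlMr ?rden_gt0//.
rewrite /rlt -(ltr_nat R) !natrD !natrM.
by apply/idP/idP => H; lra.
Qed.

Lemma qv_mkrat a b d : qv (mkrat a b d) = (a%:R - b%:R) / d.+1%:R.
Proof. by rewrite qvE /mkrat /rnum /rden !cpairK1 !cpairK2. Qed.

Lemma itv_codeE c x : @itv_of_code R c x <-> qv (cfst c) < x < qv (csnd c).
Proof.
rewrite /itv_of_code /cfst /csnd; case: (Cantor.of_nat c) => a b /=.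
by rewrite in_itv.
Qed.

Definition cell (m j : nat) : set R := [set x | j%:R <= x * m%:R <= j.+1%:R].

Lemma cell_exists m x : (0 < m)%N -> 0 <= x <= 1 ->
  exists2 j, (j < m)%N & cell m j x.
Proof.
move=> m0 /andP[x0 x1]; have xm0 : 0 <= x * m%:R by rewrite mulr_ge0.
have /andP[j1 j2] := truncn_itv xm0; have [jm|] := ltnP (Num.truncn (x * m%:R)) m.
  by exists (Num.truncn (x * m%:R)) => //; rewrite /cell/= j1 ltW.
rewrite truncn_ge_nat// => le; exists m.-1; first by rewrite prednK.
rewrite /cell/= prednK// (le_trans _ le) ?ler_nat ?leq_pred//=.
by rewrite ler_piMl.
Qed.

Lemma cell_sub01 m j x : (j < m)%N -> cell m j x -> 0 <= x <= 1.
Proof.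
move=> jm; rewrite /cell/= => /andP[h1 h2].
have m0 : 0 < m%:R :> R by rewrite ltr0n (leq_trans _ jm).
rewrite -(pmulr_lge0 x m0) (le_trans _ h1)//=.
by rewrite -(ler_pM2r m0) mul1r (le_trans h2)// ler_nat.
Qed.

Lemma grid_compact (K : set R) (P : nat -> nat -> Prop) : compact K ->
  (forall x, K x -> \forall y \near x & m \near \oo,
     forall j, cell m j y -> P m j) ->
  \forall m \near \oo, forall y, K y -> forall j, cell m j y -> P m j.
Proof.
move=> /compact_near_coveringP cK H.
exact: (cK nat \oo (fun m y => forall j, cell m j y -> P m j)).
Qed.

Lemma near_grid (Q : nat -> nat -> Prop) x (e : R) : 0 < e ->
  (\forall m \near \oo, forall j y, `|x - y| < e -> cell m j y -> Q m j) ->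
  \forall y \near x & m \near \oo, forall j, cell m j y -> Q m j.
Proof.
move=> e0 H; exists (ball x e, [set m | forall j y, `|x - y| < e -> cell m j y -> Q m j]).
  by split => //=; exact: nbhsx_ballx.
by move=> [y m] [/= xy Hm] j; apply: Hm.
Qed.

Lemma near_nat_gt x : \forall m \near \oo, x < m%:R.
Proof. exact: nbhs_infty_gtr. Qed.
End Rationals.

Section LinearEquation.
Variable R : realType.
Implicit Types (q p : baire) (a x y : R) (k m n j : nat).

Lemma coveredP q m j x : (0 < m)%N -> covered q m j -> @cell R m j x ->
  exists2 n, (n < m)%N & @itv_of_code R (q n) x.
Proof.
move=> m0 /bexistsP[n nm /andP[]]; rewrite !(rltE R) !qv_mkrat !prednK// !subr0 => h1 h2.
rewrite /cell/= => /andP[h3 h4]; have m0' : 0 < m%:R :> R by rewrite ltr0n.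
exists n => //; apply/itv_codeE.
rewrite (lt_le_trans h1) ?ler_pdivrMr//=.
by rewrite (le_lt_trans _ h2)// ler_pdivlMr.
Qed.

Lemma covered_near q n x : @itv_of_code R (q n) x ->
  \forall y \near x & m \near \oo, forall j, @cell R m j y -> covered q m j.
Proof.
move=> /itv_codeE/andP[h1 h2].
pose e := Num.min (x - @qv R (cfst (q n))) (@qv R (csnd (q n)) - x) / 2.
have e0 : 0 < e by rewrite divr_gt0// lt_min !subr_gt0 h1 h2.
have e1 : e * 2 <= x - @qv R (cfst (q n)) by rewrite divfK// ge_min lexx.
have e2 : e * 2 <= @qv R (csnd (q n)) - x by rewrite divfK// ge_min lexx orbT.
apply: (near_grid e0); near=> m; move=> j y; rewrite ltr_norml => /andP[xy1 xy2].
have m0 : 0 < m%:R :> R by near: m; exact: near_nat_gt.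
rewrite /cell/= => /andP[c1 c2]; apply/bexistsP; exists n.
  by near: m; exact: nbhs_infty_gt.
have me : 1 < e * m%:R.
  by rewrite mulrC -ltr_pdivrMr//; near: m; exact: near_nat_gt.
rewrite !(rltE R) !qv_mkrat prednK -?(ltr0n R)// !subr0.
rewrite ltr_pdivlMr// ltr_pdivrMr//; apply/andP; split.
  have : @qv R (cfst (q n)) * m%:R <= (x - e * 2) * m%:R by rewrite ler_pM2r//; lra.
  have : (x - e) * m%:R < y * m%:R by rewrite ltr_pM2r//; lra.
  move: c2; rewrite -natr1; lra.
have : (x + e * 2) * m%:R <= @qv R (csnd (q n)) * m%:R by rewrite ler_pM2r//; lra.
have : y * m%:R < (x + e) * m%:R by rewrite ltr_pM2r//; lra.
move: c1; rewrite -natr1; lra.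
Unshelve. all: by end_near.
Qed.

Section Singleton.
Variables (q : baire) (a : R).
Hypothesis a01 : 0 <= a <= 1.
Hypothesis qa : forall x, 0 <= x <= 1 -> (exists n, @itv_of_code R (q n) x) <-> x <> a.

Lemma sharpP k m : sharp q k m -> `|(first_uncovered q m)%:R / m%:R - a| < 2^-1 ^+ k.
Proof.
move=> /andP[m0 /bforallP H]; have [j jm ja] := cell_exists m0 a01.
have nc : ~~ covered q m j.
  apply/negP => /coveredP-/(_ _ m0 ja)[n _ an].
  by have [+ _] := qa a01; apply => //; exists n.
have /= := H j jm; rewrite (negbTE nc) /=.
have cj : (first_uncovered q m <= j)%N.
  by rewrite leqNgt; apply/negP => /bmin_before; rewrite nc.
move: ja; rewrite /cell/= => /andP[a1 a2].
have m0' : 0 < m%:R :> R by rewrite ltr0n.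
rewrite -(ltr_nat R) natrM natrB ?(leq_trans cj)// natrX => lt.
have k0 : 0 < 2 ^+ k :> R by rewrite exprn_gt0.
have ca : (first_uncovered q m)%:R / m%:R <= a.
  by rewrite ler_pdivrMr// (le_trans _ a1)// ler_nat.
rewrite ler0_norm ?subr_le0// opprB exprVn -[ltRHS]mul1r ltr_pdivlMr//.
rewrite -(ltr_pM2r m0') mul1r (le_lt_trans _ lt)// mulrAC ler_pM2r//.
by rewrite mulrBl divfK ?gt_eqF// lerB.
Qed.

Lemma sharp_ex k : exists m, sharp q k m.
Proof.
pose e : R := 2^-1 ^+ k / 4; have e0 : 0 < e by rewrite divr_gt0// exprn_gt0// invr_gt0.
pose K := `[(0 : R), 1] `&` ~` ball a e.
have cK : compact K.
  apply: compact_closedI; last by apply: open_closedC; exact: ball_open.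
  exact: segment_compact.
have HK x : K x -> \forall y \near x & m \near \oo, forall j, @cell R m j y -> covered q m j.
  move=> [/=]; rewrite in_itv/= => x01 xa.
  have [n xn] : exists n, @itv_of_code R (q n) x.
    by apply/(qa x01) => E; apply: xa; rewrite E; apply: ballxx.
  exact: covered_near xn.
have Hc := grid_compact cK HK.
near \oo => m.
have Hcm : forall y, K y -> forall j, @cell R m j y -> covered q m j by near: m.
have me : e^-1 < m%:R by near: m; exact: near_nat_gt.
have m0' : 0 < m%:R :> R by rewrite (lt_trans _ me)// invr_gt0.
have m0 : (0 < m)%N by rewrite -(ltr0n R).
have me1 : 1 < e * m%:R by rewrite mulrC -ltr_pdivrMr// div1r.
have unc j : (j < m)%N -> ~~ covered q m j -> `|a * m%:R - j%:R| < e * m%:R.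
  move=> jm nc; have jc : @cell R m j (j%:R / m%:R).
    by rewrite /cell/= divfK ?gt_eqF// lexx ler_nat leqnSn.
  have : ball a e (j%:R / m%:R).
    apply: contrapT => nb; move/negP: nc; apply; apply: (Hcm _ _ _ jc).
    by split=> //=; rewrite in_itv/=; exact: (cell_sub01 jm jc).
  rewrite /ball/= -(ltr_pM2r m0') -[X in `|_| * X](ger0_norm (ltW m0')) -normrM.
  by rewrite mulrBl divfK ?gt_eqF.
exists m; rewrite /sharp m0 /=; apply/bforallP => j jm.
have [//|/negbTE nc/=] := boolP (covered q m j).
have ex : bexists m (fun j => ~~ covered q m j) by apply/bexistsP; exists j; rewrite // nc.
set c := first_uncovered q m.
have cm : (c < m)%N by rewrite /c /first_uncovered bmin_lt.
have cj : (c <= j)%N by rewrite leqNgt; apply/negP => /bmin_before; rewrite nc.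
have := unc _ cm (bminP ex); have := unc _ jm (negbT nc).
rewrite -/c !ltr_norml => /andP[j1 j2] /andP[c1 c2].
rewrite -(ltr_nat R) natrM natrB ?(leq_trans cj)// natrX.
have k0 : 0 < 2 ^+ k :> R by rewrite exprn_gt0.
rewrite -ltr_pdivlMr//.
have -> : m%:R / 2 ^+ k = 4 * e * m%:R.
  by rewrite /e exprVn; field; rewrite ?gt_eqF.
by rewrite -natr1; lra.
Unshelve. all: by end_near.
Qed.
End Singleton.

End LinearEquation.

Lemma onth_mkseq (T : Type) (f : nat -> T) n i :
  onth (mkseq f n) i = if (i < n)%N then Some (f i) else None.
Proof.
have [lt|ge] := ltnP i n; last by rewrite onth_default ?size_mkseq.
have := onthTE (mkseq f n) i; rewrite size_mkseq lt.
by case E: onth => [y|] // _; rewrite -(@onth_nth _ (f 0%N) _ _ _ E) nth_mkseq.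
Qed.

Lemma seq_names_mkseq (X : rep_space) p n (f : nat -> X) :
  p 0%N = n -> (forall i, (i < n)%N -> names (slice p i) (f i)) ->
  @seq_names X p (mkseq f n).
Proof.
move=> pn H; split; first by rewrite size_mkseq.
by move=> i x; rewrite onth_mkseq; case: ifP => // /H + [<-].
Qed.

Lemma Forall2_onth (A B : Type) (f : A -> B -> Prop) xs ys :
  List.Forall2 f xs ys <->
  size xs = size ys /\
  forall i x y, onth xs i = Some x -> onth ys i = Some y -> f x y.
Proof.
split=> [|[]].
  elim=> [|x y s t fxy _ [st IH]]; first by split=> // i x y; rewrite onth0n.
  split=> [|[|i] a b]; first by rewrite /= st.
    by move=> [<-] [<-].
  exact: IH.
elim: xs ys => [|x s IH] [|y t]//= [st] H; constructor; first exact: (H 0%N).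
by apply: IH => // i; exact: (H i.+1).
Qed.

Lemma onth_lt (T : Type) (s : seq T) i : (i < size s)%N -> exists x, onth s i = Some x.
Proof. by rewrite -onthTE; case: (onth s i) => // x _; exists x. Qed.

Lemma Forall2_mkseql (A B : Type) (f : A -> B -> Prop) (g : nat -> A) n ys :
  List.Forall2 f (mkseq g n) ys <->
  size ys = n /\ forall i y, onth ys i = Some y -> f (g i) y.
Proof.
rewrite Forall2_onth size_mkseq; split=> -[E H]; split=> // i.
  move=> y yi; have lt : (i < size ys)%N by rewrite -onthTE yi.
  by apply: (H i) => //; rewrite onth_mkseq E lt.
by move=> x y; rewrite onth_mkseq; case: ifP => // _ [<-]; exact: H.
Qed.

Lemma first_hitE q n k : hit q n -> bexists k.+1 (hit q) -> first_hit q k = first_hit q n.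
Proof.
move=> hn ex; have exn : bexists n.+1 (hit q) by apply/bexistsP; exists n.
rewrite /first_hit; case/orP: (leq_total n k) => le.
  by rewrite (@bmin_widen n.+1).
by rewrite (@bmin_widen k.+1 n.+1).
Qed.

Lemma first_hit_late q n k : hit q n -> ~~ bexists k.+1 (hit q) -> (k < first_hit q n)%N.
Proof.
move=> hn nex; rewrite ltnNge; apply/negP => le; move/negP: nex; apply.
apply/bexistsP; exists (first_hit q n) => //.
by apply: bminP; apply/bexistsP; exists n.
Qed.

Section Reduction1.
Variable R : realType.

Lemma BRoot_total (P : poly_space R) : exists x, BRoot P x.
Proof.
have [[y [y01 Py]]|N] := pselect (exists y : R, 0 <= y <= 1 /\ root P y).
  by exists (exist _ y y01).
have o : 0 <= (0 : R) <= 1 by rewrite lexx ler01.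
by exists (exist _ 0 o) => /N.
Qed.

Lemma hitP q n : hit q n <-> exists2 x : R, 0 <= x <= 1 & itv_of_code (q n) x.
Proof.
rewrite /hit !(rltE R) !qv_mkrat !subr0 divr1 mul0r; split.
  move=> /and3P[ab a1 b0]; set a := qv R _ in ab a1; set b := qv R _ in ab b0.
  have ml : Num.max a 0 < Num.min b 1 by rewrite lt_min !gt_max ab a1 b0 ltr01.
  have [m1 m2] := midf_lt ml; exists ((Num.max a 0 + Num.min b 1) / 2).
    rewrite (le_trans _ (ltW m1)) ?le_max ?lexx ?orbT//=.
    by rewrite (le_trans (ltW m2))// ge_min lexx orbT.
  apply/itv_codeE; rewrite -/a -/b (le_lt_trans _ m1) ?le_max ?lexx//=.
  by rewrite (lt_le_trans m2)// ge_min lexx.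
move=> [x /andP[x0 x1] /itv_codeE/andP[ax xb]].
by rewrite (lt_trans ax xb) (lt_le_trans ax) ?(le_lt_trans _ xb).
Qed.

Lemma slope_names q n0 : hit q n0 ->
  real_names (slope q) ((2^-1 : R) ^+ first_hit q n0).
Proof.
move=> h0 k; rewrite -/(qv R _) /slope; case: ifPn => [ex|nex].
  rewrite (first_hitE h0 ex) qv_mkrat prednK ?expn_gt0// subr0 natrX !exprVn div1r subrr normr0.
  by rewrite invr_gt0 exprn_gt0.
rewrite qv_mkrat subrr mul0r sub0r normrN ger0_norm ?exprn_ge0 ?invr_ge0//.
have lt := first_hit_late h0 nex.
by rewrite ltr_iXn2l// ?invr_gt0// invf_lt1// ltr1n.
Qed.

Lemma intercept_names q n0 (a : R) (mu : nat -> nat) : hit q n0 -> 0 <= a <= 1 ->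
  (forall k, bexists k.+1 (hit q) ->
    (0 < mu k)%N /\ `|(first_uncovered q (mu k))%:R / (mu k)%:R - a| < 2^-1 ^+ k) ->
  real_names (fun k => intercept q k (mu k)) (- ((2^-1 : R) ^+ first_hit q n0 * a)).
Proof.
move=> h0 /andP[a0 a1] Hmu k; rewrite -/(qv R _) /intercept opprK; case: ifPn => [ex|nex].
  have [m0 Hk] := Hmu k ex; rewrite (first_hitE h0 ex) qv_mkrat prednK ?muln_gt0 ?expn_gt0//= sub0r.
  have -> : - (first_uncovered q (mu k))%:R / (2 ^ first_hit q n0 * mu k)%:R +
      2^-1 ^+ first_hit q n0 * a =
      - (2^-1 ^+ first_hit q n0 * ((first_uncovered q (mu k))%:R / (mu k)%:R - a)).
    rewrite natrM natrX exprVn; field.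
    by rewrite expf_neq0 ?pnatr_eq0 ?andbT -?lt0n.
  rewrite normrN normrM ger0_norm ?exprn_ge0 ?invr_ge0//.
  apply: le_lt_trans Hk; apply: ler_piMl => //.
  by rewrite exprn_ile1 ?invr_ge0// invf_le1// ler1n.
rewrite qv_mkrat subrr mul0r add0r ger0_norm ?mulr_ge0 ?exprn_ge0 ?invr_ge0//.
have lt := first_hit_late h0 nex.
apply: (@le_lt_trans _ _ (2^-1 ^+ first_hit q n0)).
  by rewrite ler_piMr// exprn_ge0// invr_ge0.
by rewrite ltr_iXn2l// ?invr_gt0// invf_lt1// ltr1n.
Qed.

Definition full_or_point (A : set R) : Prop :=
  A = `[0, 1]%classic \/ exists a, A = [set a].

Lemma closed_namesE q (A : closed_unit_subset R) : closed_names q A ->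
  forall x : R, 0 <= x <= 1 -> (exists n, itv_of_code (q n) x) <-> ~ sval A x.
Proof.
rewrite /closed_names => E x x01.
have [E1 E2] : (`[0, 1]%classic `&` \bigcup_n itv_of_code (q n)) x <->
    (`[0, 1]%classic `\` sval A) x by rewrite E.
have x01' : `[0, 1]%classic x by rewrite /= in_itv.
split=> [[n nx]|Ax]; first by have [] := E1 (conj x01' (ex_intro2 _ _ n I nx)).
by have [_ [n _ nx]] := E2 (conj x01' Ax); exists n.
Qed.

Lemma linear_component q (A : closed_unit_subset R) :
  closed_names q A -> full_or_point (sval A) ->
  (forall k, bexists k.+1 (hit q) -> exists m, sharp q k m) /\
  exists P : poly_space R, [/\ (size P <= 2)%N,
    forall mu : nat -> nat, (forall k, bexists k.+1 (hit q) -> sharp q k (mu k)) ->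
      real_names (fun k => intercept q k (mu k)) P`_0,
    real_names (slope q) P`_1 &
    forall x, BRoot P x -> AoUC A x].
Proof.
move=> /closed_namesE qA fA; have [A1|[a Aa]] := fA.
  have nh n : ~~ hit q n.
    apply/negP => /hitP[x x01 xn]; have [+ _] := qA x x01; apply; first by exists n.
    by rewrite A1 /= in_itv.
  have nb k : bexists k (hit q) = false.
    by apply/negP => /bexistsP[n _]; rewrite (negbTE (nh n)).
  split=> [k|]; first by rewrite nb.
  have z : real_names (fun=> mkrat 0 0 0) (0 : R).
    by move=> k; rewrite -/(qv R _) qv_mkrat !subr0 mul0r normr0 exprn_gt0// invr_gt0.
  exists (0 : {poly R}); split; rewrite ?size_poly0 ?coef0//.
  - by move=> mu _; move: z; congr real_names; apply/funext => k; rewrite /intercept nb.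
  - by move: z; congr real_names; apply/funext => k; rewrite /slope nb.
  - move=> [x x01] _; split; first by left.
    by rewrite A1 /= in_itv.
have a01 : 0 <= a <= 1.
  by case: A {qA fA} Aa => A [cA sA] /= Aa; have := sA a; rewrite Aa /= in_itv; exact.
have qa x : 0 <= x <= 1 -> (exists n, itv_of_code (q n) x) <-> x <> a.
  by move=> x01; rewrite (qA x x01) Aa.
split=> [k _|]; first exact: (sharp_ex (a := a)).
have [n0 h0] : exists n, hit q n.
  pose b : R := if a == 0 then 1 else 0.
  have b01 : 0 <= b <= 1 by rewrite /b; case: ifP; rewrite lexx ler01.
  have [|n bn] := (qa b b01).2; last by exists n; apply/hitP; exists b.
  by rewrite /b; case: eqP => [-> /eqP|+ E]; [rewrite oner_eq0|rewrite -E].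
pose s : R := 2^-1 ^+ first_hit q n0.
have s0 : 0 < s by rewrite exprn_gt0// invr_gt0.
exists (s *: 'X - (s * a)%:P : {poly R}); split.
- rewrite (leq_trans (size_polyD _ _))// geq_max (leq_trans (size_scale_leq _ _)) ?size_polyX//=.
  by rewrite size_polyN (leq_trans (size_polyC_leq1 _)).
- move=> mu Hmu; rewrite coefB coefZ coefX coefC mulr0 sub0r.
  apply: intercept_names => // k /Hmu sh; split; first by case/andP: sh.
  exact: (sharpP a01).
- by rewrite coefB coefZ coefX coefC mulr1 subr0; exact: slope_names.
- move=> [x x01] /= Hx; split; first by right; exists a.
  have /Hx : exists y : R, 0 <= y <= 1 /\ root (s *: 'X - (s * a)%:P) y.
    by exists a; split=> //; rewrite rootE !hornerE subrr.
  rewrite rootE !hornerE /= -mulrBr mulf_eq0 gt_eqF//= subr_eq0 Aa => /eqP ->.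
  by [].
Qed.

Lemma AoUC_star_le_BRoot_star : weihrauch_le (star (@AoUC R)) (star (@BRoot R)).
Proof.
exists (fun p => Some (odds p)), (search linear_ok linear_out).
split; [exact: odds_computable|exact: linear_computable|].
move=> G HG p xs [p0 pn] [ys0 /Forall2_onth[sxy Hdom]].
have Hdom' i A : onth xs i = Some A -> full_or_point (sval A).
  move=> xi; have lt : (i < size xs)%N by rewrite -onthTE xi.
  have lty : (i < size ys0)%N by rewrite -sxy.
  by have [y yi] := onth_lt lty; have [] := Hdom _ _ _ xi yi.
have Hcomp i A (xi : onth xs i = Some A) := linear_component (pn i A xi) (Hdom' i A xi).
have tot n : exists m, linear_ok p n m.
  rewrite /linear_ok; case: (ltnP (cfst n.-1) (p 0%N)) => [lt|_] /=; last by exists 0%N.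
  case: (boolP (bexists _ _)) => [|_] /=; last by exists 0%N.
  have ltx : (cfst n.-1 < size xs)%N by rewrite -p0.
  have [A xi] := onth_lt ltx.
  exact: (Hcomp _ _ xi).1.
rewrite /search; case: pselect => // H.
pose K n := linear_out p n (ex_minn (H n)).
have HP i : exists P : poly_space R, (i < size xs)%N ->
    poly_names (slice K i) P /\
    forall A x, onth xs i = Some A -> BRoot P x -> AoUC A x.
  have [lt|_] := ltnP i (size xs); last by exists (0 : {poly R}).
  have [A xi] := onth_lt lt; have [_ [P [sP P0 P1 PA]]] := Hcomp _ _ xi.
  exists P => _; split; last by move=> B x; rewrite xi => -[<-]; exact: PA.
  have K0 : slice K i 0%N = 1%N by rewrite sliceE /K /linear_out /= cpairK1 cpairK2.
  split; first by rewrite K0.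
  rewrite K0 => -[|[|//]] _.
    have -> : slice (slice K i) 0 = (fun k =>
       intercept (slice p i) k (ex_minn (H (cpair i (cpair 0 k).+1).+1))).
      by apply/funext => k; rewrite !sliceE /K /linear_out /= ?(cpairK1, cpairK2) /= ?(cpairK1, cpairK2).
    apply: P0 => k Hk; case: ex_minnP => m + _.
    by rewrite /linear_ok /= ?(cpairK1, cpairK2) /= ?(cpairK1, cpairK2) p0 lt Hk.
  have -> : slice (slice K i) 1 = slope (slice p i).
    by apply/funext => k; rewrite !sliceE /K /linear_out /= ?(cpairK1, cpairK2) /= ?(cpairK1, cpairK2).
  exact: P1.
have {HP}[P HP] := choice HP.
have KP : @seq_names (poly_space R) K (mkseq P (size xs)).
  apply: seq_names_mkseq; first by rewrite /K /linear_out /= p0.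
  by move=> i /HP[].
have [|r [ys [GK rys /Forall2_mkseql[sy Hy]]]] := HG K _ KP.
  have [t Ht] := choice (fun P : poly_space R => BRoot_total P).
  exists [seq t Q | Q <- mkseq P (size xs)].
  by elim: (mkseq _ _) => [|Q s IH] /=; constructor.
exists r, ys; split=> //=; first by rewrite -/K GK /= odds_pair.
apply/Forall2_onth; split=> // i A y xi yi.
have lt : (i < size xs)%N by rewrite -onthTE xi.
have [_ HA] := HP i lt.
exact/HA/Hy.
Qed.
End Reduction1.

(** * Thom's lemma *)

Section Thom.
Variable R : realType.
Implicit Types (P : {poly R}) (x y z v : R) (s : nat -> bool).

Definition signed (b : bool) v : bool := if b then 0 <= v else v <= 0.

Lemma signed0 b : signed b 0.
Proof. by case: b => /=. Qed.

Lemma signed_between b u v w :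
  signed b u -> signed b w -> (u <= v <= w) || (w <= v <= u) -> signed b v.
Proof. by case: b => /= hu hw /orP[] /andP[h1 h2]; lra. Qed.

Lemma thom_between n P s x y z : (size P <= n)%N -> x <= z <= y ->
  (forall k, (k < n)%N -> signed (s k) P^`(k).[x] && signed (s k) P^`(k).[y]) ->
  signed (s 0%N) P.[z].
Proof.
elim: n P s z => [|n IH] P s z sP xzy H.
  by move: sP; rewrite leqn0 size_poly_eq0 => /eqP ->; rewrite horner0 signed0.
have dP w : x <= w <= y -> signed (s 1%N) P^`().[w].
  move=> xwy; apply: (IH _ (fun k => s k.+1)) => //.
    have [->|P0] := eqVneq P 0; first by rewrite deriv0 size_poly0.
    by rewrite -ltnS (leq_trans (lt_size_deriv P0)).
  by move=> k kn; have := H k.+1 kn; rewrite derivSn.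
have /andP[Hx Hy] := H 0%N isT; rewrite !derivn0 in Hx Hy.
have [xz zy] := andP xzy; have xy := le_trans xz zy.
apply: (signed_between Hx Hy).
have mon Q : (forall w, x <= w <= y -> 0 <= Q^`().[w]) -> Q.[x] <= Q.[z] <= Q.[y].
  move=> HQ; have H' : {in `[x, y] &, {homo horner Q : u v / u <= v}}.
    by apply: ler_hornerW => w; rewrite in_itv/= => /andP[xw wy]; apply: HQ; rewrite !ltW.
  by rewrite !H' // in_itv/= ?lexx ?xy.
case: (s 1%N) dP => /= dP; first by rewrite mon.
have := mon (- P); rewrite derivN !hornerN !lerN2 andbC => ->; first by rewrite orbT.
by move=> w /dP; rewrite hornerN oppr_ge0.
Qed.

Lemma poly_zero_on P x y : x < y -> (forall z, x <= z <= y -> root P z) -> P = 0.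
Proof.
move=> xy H; apply/eqP; apply: contraT => P0.
pose f i : R := x + (y - x) / i.+1%:R.
have := @max_poly_roots _ P (mkseq f (size P)) P0; rewrite size_mkseq ltnn; apply.
  apply/allP => _ /mapP[i _ ->]; apply: H; rewrite /f.
  have yx : 0 <= y - x by rewrite subr_ge0 ltW.
  rewrite lerDl divr_ge0//= -lerBrDl ler_pdivrMr// ler_peMr//.
  by rewrite ler1n.
rewrite map_inj_uniq ?iota_uniq// => i j /addrI/mulfI E.
have /E/invr_inj/eqP : y - x != 0 by rewrite subr_eq0 gt_eqF.
by rewrite eqr_nat => /eqP[].
Qed.

Lemma thom_unique P s x y : P != 0 -> root P x -> root P y ->
  (forall k, (k.+1 < size P)%N ->
     signed (s k) P^`(k.+1).[x] && signed (s k) P^`(k.+1).[y]) -> x = y.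
Proof.
wlog xy : x y / x <= y.
  move=> W P0 Px Py H; case/orP: (le_total x y) => xy; first exact: W xy P0 Px Py H.
  by symmetry; apply: W xy P0 Py Px _ => k /H; rewrite andbC.
move=> P0 Px Py H; apply/eqP; rewrite eq_le xy leNgt; apply/negP => xy'.
case/negP: P0; apply/eqP; apply: (poly_zero_on xy') => z xzy.
have sg b : signed b P.[z].
  apply: (@thom_between _ _ (fun k => if k is j.+1 then s j else b) _ _ _ (leqnn _) xzy).
  move=> [|k] kP; last exact: H.
  by rewrite derivn0 (rootP Px) (rootP Py) signed0.
by rewrite rootE eq_le; have := sg true; have := sg false; rewrite /= => -> ->.
Qed.

Definition sgbit (sg k : nat) : bool := odd (sg %/ 2 ^ k).

Lemma sgbit_ex N s : exists2 sg, (sg < 2 ^ N)%N & forall k, (k < N)%N -> sgbit sg k = s k.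
Proof.
elim: N s => [|N IH] s; first by exists 0%N.
have [t tN Ht] := IH (fun k => s k.+1); exists (s 0%N + t.*2)%N.
  by rewrite expnS; case: (s 0%N) => /=; lia.
move=> [|k] kN; first by rewrite /sgbit expn0 divn1 oddD odd_double addbF; case: (s 0%N).
rewrite -Ht // /sgbit expnS divnMA; congr (odd (_ %/ _)).
by rewrite divn2 halfD odd_double andbF add0n doubleK; case: (s 0%N).
Qed.

Definition solutions P (N sg : nat) : set R :=
  [set x | [/\ 0 <= x <= 1, root P x &
    forall k, (k < N)%N -> signed (sgbit sg k) P^`(k.+1).[x]]].

Lemma solutions0 N sg : solutions 0 N sg = `[0, 1]%classic.
Proof.
apply/seteqP; split=> x /=; rewrite in_itv/=; first by case.
move=> x01; split=> // [|k _]; first by rewrite root0.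
by rewrite raddf0 horner0 signed0.
Qed.

Lemma solutions_unique P N sg x y : (size P <= N.+1)%N -> P != 0 ->
  solutions P N sg x -> solutions P N sg y -> x = y.
Proof.
move=> sP P0 [_ Px Hx] [_ Py Hy].
apply: (@thom_unique P (sgbit sg)) => // k kP.
have kN : (k < N)%N by rewrite -ltnS (leq_trans kP).
by rewrite Hx ?Hy.
Qed.

Lemma solutions_cover P N x : 0 <= x <= 1 -> root P x ->
  exists2 sg, (sg < 2 ^ N)%N & solutions P N sg x.
Proof.
move=> x01 Px; have [sg sgN H] := sgbit_ex N (fun k => 0 <= P^`(k.+1).[x]).
exists sg => //; split=> // k kN; rewrite H// /signed.
by case: ifPn => //; rewrite -ltNge => /ltW.
Qed.
End Thom.

Section Certificates.
Variables (R : realType) (q : baire) (P : {poly R}).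
Hypothesis qP : poly_names q P.
Let N := q 0%N.

Lemma coef_gt i : (N < i)%N -> P`_i = 0.
Proof. by case: qP => sP _ Ni; rewrite nth_default// (leq_trans sP). Qed.

Lemma scoef_err i m : (i <= N)%N ->
  `|(scoef true q i m)%:R - (scoef false q i m)%:R - (2 ^ m)%:R * P`_i| <= 2.
Proof.
move=> iN; rewrite /scoef iN; set c := slice q i m.
have := (proj2 qP) i iN m; rewrite -/c -/(qv R c) qvE.
set D : R := (2 ^ m)%:R; have D0 : 0 < D by rewrite ltr0n expn_gt0.
have d0 : (0 < rden c)%N by [].
set u : R := (rnum true c)%:R; set v : R := (rnum false c)%:R; set d : R := (rden c)%:R.
have d0' : 0 < d by rewrite ltr0n.
have fl b : (rnum b c)%:R * D / d - 1 <= (rnum b c * 2 ^ m %/ rden c)%:R <= (rnum b c)%:R * D / d.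
  have E := divn_eq (rnum b c * 2 ^ m) (rden c); have L := ltn_pmod (rnum b c * 2 ^ m) d0.
  rewrite lerBlDr natr1 ler_pdivrMr// ler_pdivlMr// /D /d -!natrM !ler_nat.
  by apply/andP; split; nia.
have -> : (2^-1 : R) ^+ m = D^-1 by rewrite /D natrX exprVn.
have /andP[u1 u2] := fl true; have /andP[v1 v2] := fl false.
rewrite -/u -/v in u1 u2 v1 v2 *.
rewrite -(ltr_pM2l D0) divff ?gt_eqF// -{1}(gtr0_norm D0) -normrM ltr_norml mulrBr.
have -> : D * ((u - v) / d) = u * D / d - v * D / d by field; rewrite gt_eqF.
by rewrite ler_norml => /andP[h1 h2]; apply/andP; split; lra.
Qed.

Lemma cbound_ge i : (i <= N)%N -> `|P`_i| <= (cbound q i)%:R.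
Proof.
move=> iN; rewrite /cbound iN; set c := slice q i 0.
have := (proj2 qP) i iN 0%N; rewrite -/c -/(qv R c) qvE expr0 distrC => H.
set u : R := (rnum true c)%:R in H *; set v : R := (rnum false c)%:R in H *.
have d1 : 1 <= (rden c)%:R :> R by rewrite ler1n.
have le b : 0 <= ((rnum b c)%:R / (rden c)%:R : R) <= (rnum b c)%:R.
  by rewrite divr_ge0//= ler_pdivrMr ?(lt_le_trans ltr01 d1)// ler_peMr.
have /andP[u1 u2] := le true; have /andP[v1 v2] := le false; rewrite -/u -/v in u1 u2 v1 v2.
move: H; rewrite !natrD -/u -/v mulrBl ltr_norml ler_norml => /andP[h1 h2].
by apply/andP; split; lra.
Qed.

Lemma exp_lipschitz (x y : R) i : 0 <= x <= 1 -> 0 <= y <= 1 ->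
  `|x ^+ i - y ^+ i| <= i%:R * `|x - y|.
Proof.
move=> /andP[x0 x1] /andP[y0 y1]; elim: i => [|i IH]; first by rewrite !expr0 subrr normr0 mul0r.
have -> : x ^+ i.+1 - y ^+ i.+1 = x * (x ^+ i - y ^+ i) + y ^+ i * (x - y).
  by rewrite !exprS; ring.
rewrite (le_trans (ler_normD _ _))// !normrM (ger0_norm x0) (ger0_norm (exprn_ge0 _ y0)).
rewrite -natr1 mulrDl mul1r lerD//.
  by rewrite (le_trans _ IH)// ler_piMl.
by rewrite ler_piMl// exprn_ile1.
Qed.

Lemma hnum_err k m j x : (j <= 2 ^ m)%N -> 0 <= x <= 1 -> @cell R (2 ^ m) j x ->
  `|(hnum true q k m j)%:R - (hnum false q k m j)%:R - (2 ^ m)%:R ^+ N.+1 * P^`(k).[x]|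
  <= ((2 ^ m) ^ N * errb q k)%:R.
Proof.
move=> jm x01 /andP[x1 x2].
rewrite (@horner_coef_wide _ N.+1); last first.
  apply/leq_sizeP => i iN; rewrite coef_derivn coef_gt ?mul0rn//.
  by rewrite (leq_trans iN)// leq_addl.
rewrite /hnum /errb !natr_sum -/N natrM natr_sum !big_mkord mulr_sumr -!sumrB mulr_sumr.
apply: le_trans (ler_norm_sum _ _ _) _; apply: ler_sum => -[i /= iN] _.
have {}iN : (i <= N)%N by rewrite -ltnS.
rewrite coef_derivn !natrM !natrX natrD natrM.
set D : R := 2%:R ^+ m; have D0 : 0 < D by rewrite exprn_gt0.
set f : R := ((k + i) ^_ k)%:R; have f0 : 0 <= f by [].
have [kN|kN] := leqP (k + i) N; last first.
  rewrite coef_gt // /scoef -/N leqNgt kN /= !mul0r mul0rn mul0r mulr0 !subrr normr0.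
  apply: mulr_ge0; first exact/exprn_ge0/ltW.
  by apply: mulr_ge0 => //; apply: addr_ge0 => //; apply: mulr_ge0.
have h1 := scoef_err m kN; have h2 := cbound_ge kN.
set T : R := (scoef true _ _ _)%:R in h1 *; set F : R := (scoef false _ _ _)%:R in h1 *.
set a := P`_(k + i) in h1 h2 *; set B : R := (cbound _ _)%:R in h2 *.
rewrite natrX -/D in h1; rewrite -[a *+ _]mulr_natr -/f.
pose y : R := j%:R / D.
have y01 : 0 <= y <= 1.
  have -> : 0 <= y by apply: divr_ge0 => //; exact: ltW.
  by rewrite ler_pdivrMr// mul1r /D -natrX ler_nat.
have jE : j%:R = D * y by rewrite /y mulrC divfK// gt_eqF.
have DN : D ^+ N = D ^+ i * D ^+ (N - i) by rewrite -exprD subnKC.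
have -> : T * f * (j%:R ^+ i * D ^+ (N - i)) - F * f * (j%:R ^+ i * D ^+ (N - i)) -
    D ^+ N.+1 * (a * f * x ^+ i) =
    D ^+ N * (f * ((T - F - D * a) * y ^+ i + a * (D * (y ^+ i - x ^+ i)))).
  by rewrite exprS jE exprMn DN; ring.
rewrite normrM (ger0_norm (exprn_ge0 _ (ltW D0))) ler_pM2l ?exprn_gt0//.
rewrite normrM (ger0_norm f0) ler_wpM2l//.
rewrite (le_trans (ler_normD _ _))// lerD//.
  rewrite normrM (le_trans _ h1)// ler_piMr// ger0_norm ?exprn_ge0 ?exprn_ile1//; by case/andP: y01.
rewrite normrM mulrC ler_pM// normrM (gtr0_norm D0).
apply: (@le_trans _ _ (D * (i%:R * `|y - x|))).
  by rewrite ler_pM2l// exp_lipschitz.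
rewrite mulrCA ler_piMr// -{1}(gtr0_norm D0) -normrM mulrBr -jE ler_norml.
move: x1 x2; rewrite natrX -/D -natr1 => x1 x2; apply/andP; split; lra.
Qed.

Lemma cert_sound b k m j x : (j < 2 ^ m)%N -> @cell R (2 ^ m) j x -> cert b q k m j ->
  if b then 0 < P^`(k).[x] else P^`(k).[x] < 0.
Proof.
move=> jm xc; have x01 := cell_sub01 jm xc.
have := hnum_err k (ltnW jm) x01 xc; rewrite /cert -(ltr_nat R) natrD -/N ler_norml.
set E : R := (_ * errb _ _)%:R; set D : R := (2 ^ m)%:R ^+ _ => /andP[h1 h2].
have D0 : 0 < D by rewrite exprn_gt0// ltr0n expn_gt0.
case: b => /= H.
  by rewrite -(pmulr_rgt0 _ D0); lra.
by rewrite -(pmulr_rlt0 _ D0); lra.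
Qed.

Lemma cert_complete b k m j x : (j < 2 ^ m)%N -> @cell R (2 ^ m) j x ->
  (errb q k * 2)%:R < (2 ^ m)%:R * (if b then P^`(k).[x] else - P^`(k).[x]) ->
  cert b q k m j.
Proof.
move=> jm xc H; have x01 := cell_sub01 jm xc.
have := hnum_err k (ltnW jm) x01 xc; rewrite /cert -(ltr_nat R) natrD -/N ler_norml.
rewrite natrM natrX; set D : R := (2 ^ m)%:R in H *; set E : R := (errb _ _)%:R.
have D0 : 0 < D ^+ N by rewrite exprn_gt0// ltr0n expn_gt0.
rewrite natrM -/E in H; move=> /andP[h1 h2].
rewrite -(ltr_pM2l D0) !mulrA -exprSr in H.
by case: b H => /= H; rewrite ?mulrN in H; lra.
Qed.

Lemma dead_sound sg m j x : (j < 2 ^ m)%N -> @cell R (2 ^ m) j x ->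
  dead q sg m j -> ~ solutions P N sg x.
Proof.
move=> jm xc /or3P[/(cert_sound jm xc)|/(cert_sound jm xc)|/bexistsP[k kN /(cert_sound jm xc)]].
- by rewrite /= ?derivn0 => H [_ /rootP Px]; rewrite Px ltxx in H.
- by rewrite /= ?derivn0 => H [_ /rootP Px]; rewrite Px ltxx in H.
- by move=> H [_ _ /(_ k kN)]; move: H; rewrite /sgbit /signed; case: odd => /=; rewrite ltNge => /negP.
Qed.

Lemma cert_near b k x : 0 < (if b then P^`(k).[x] else - P^`(k).[x]) ->
  \forall y \near x & m \near \oo, forall j, (j < 2 ^ m)%N ->
    @cell R (2 ^ m) j y -> cert b q k m j.
Proof.
pose h (y : R) := if b then P^`(k).[y] else - P^`(k).[y]; rewrite -/(h x) => hx.
have hc : {for x, continuous h}.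
  rewrite /h; case: (b); first exact: continuous_horner.
  by apply: continuousN; exact: continuous_horner.
have h2 : h x / 2 < h x by rewrite ltr_pdivrMr// mulr_natr mulr2n ltrDl.
have n1 : \forall y \near x, h x / 2 < h y by apply: (cvgr_gt (h x) hc).
have n2 : \forall m \near \oo, (errb q k * 2)%:R / (h x / 2) < (m%:R : R) := near_nat_gt _.
exists ([set y | h x / 2 < h y], [set m | (errb q k * 2)%:R / (h x / 2) < (m%:R : R)]) => //.
move=> [y m] [/= hy hm] j jm yc; apply: (cert_complete jm yc); rewrite -/(h y).
have p0 : 0 < h x / 2 by rewrite divr_gt0.
rewrite ltr_pdivrMr// in hm; apply: (lt_trans hm).
apply: (@lt_trans _ _ ((2 ^ m)%:R * (h x / 2))).
  by rewrite ltr_pM2r// ltr_nat ltn_expl.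
by rewrite ltr_pM2l// ltr0n expn_gt0.
Qed.

Lemma dead_complete sg x : 0 <= x <= 1 -> ~ solutions P N sg x ->
  \forall y \near x & m \near \oo, forall j, (j < 2 ^ m)%N ->
    @cell R (2 ^ m) j y -> dead q sg m j.
Proof.
move=> x01 nx.
have [Px|/negP] := pselect (root P x); last first.
  rewrite rootE neq_lt => /orP[Px|Px].
    have := @cert_near false 0 x; rewrite derivn0 oppr_gt0 => /(_ Px).
    by apply: filterS => -[y m] /= H j jm yc; rewrite /dead H ?orbT.
  have := @cert_near true 0 x; rewrite derivn0 => /(_ Px).
  by apply: filterS => -[y m] /= H j jm yc; rewrite /dead H.
have [k [kN sk]] : exists k, (k < N)%N /\ ~~ signed (sgbit sg k) P^`(k.+1).[x].
  apply: contrapT => nk; apply: nx; split=> // k kN.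
  by apply: contraT => sk; exfalso; apply: nk; exists k.
have sk' : 0 < (if ~~ sgbit sg k then P^`(k.+1).[x] else - P^`(k.+1).[x]).
  by move: sk; rewrite /signed; case: sgbit => /=; rewrite -ltNge ?oppr_gt0.
have := cert_near sk'.
apply: filterS => -[y m] /= H j jm yc; rewrite /dead.
by apply/or3P/Or33/bexistsP; exists k => //; apply: H.
Qed.
End Certificates.

(** * Choosing among sign conditions *)

Section Freeze.
Variable R : realType.
Implicit Types (c j : nat) (x y : R) (l r : nat -> bool).

Lemma itv_code0 x : ~ itv_of_code 0 x.
Proof. by move=> /itv_codeE/andP[h1 /(lt_trans h1)]; rewrite ltxx. Qed.

Lemma freezeP c x : 0 <= x <= 1 ->
  (exists j, itv_of_code (freeze c j) x) <-> x <> qv R c.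
Proof.
move=> /andP[x0 x1]; split=> [[j]|/eqP].
  rewrite /freeze; case: ifP => _ /itv_codeE; rewrite !(cpairK1, cpairK2) => /andP[h1 h2] E.
    by rewrite E ltxx in h2.
  by rewrite E ltxx in h1.
rewrite neq_lt => /orP[lt|gt]; [exists 0%N|exists 1%N]; apply/itv_codeE;
  rewrite /freeze /= !(cpairK1, cpairK2) qv_mkrat ?lt ?gt ?andbT /= divr1; lra.
Qed.

Lemma emit2P l r : exists B : set R,
  [/\ [\/ B = `[0, 1]%classic /\ forall m, ~~ l m /\ ~~ r m,
          B = [set 0] /\ exists m, r m | B = [set 1] /\ exists m, l m] &
   forall x, 0 <= x <= 1 -> (exists m j, itv_of_code (emit2 l r m j) x) <-> ~ B x].
Proof.
pose t m := l m || r m.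
have [ex|nex] := pselect (exists m, t m); last first.
  have nt m : t m = false by apply/negP => tm; apply: nex; exists m.
  exists `[0, 1]%classic; split.
    by constructor 1; split=> // m; have := nt m; rewrite /t => /norP.
  move=> x x01; split=> [[m [j]]|]; first by rewrite /emit2 -/(t m) nt => /itv_code0.
  by rewrite /= in_itv /= x01.
pose s := ex_minn ex; have [ts smin] : t s /\ forall m, t m -> (s <= m)%N.
  by rewrite /s; case: ex_minnP.
have first m : t m -> bmin m.+1 t = s.
  move=> tm; have es : bexists s.+1 t by apply/bexistsP; exists s.
  rewrite (@bmin_widen s.+1) ?ltnS ?smin//.
  by apply/eqP; rewrite eqn_leq smin ?(bminP es)// -ltnS bmin_lt es.
pose c : nat := if r s then mkrat 0 0 0 else mkrat 1 0 0.
have emitE m j : t m -> emit2 l r m j = freeze c j.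
  by move=> tm; rewrite /emit2 -/(t m) tm (first m tm).
exists [set qv R c]; split.
  rewrite /c; have := ts; rewrite /t; case: (boolP (r s)) => [rs _|_ /orP[ls|//]].
    by constructor 2; rewrite qv_mkrat subrr mul0r; split=> //; exists s.
  by constructor 3; rewrite qv_mkrat subr0 divr1; split=> //; exists s.
move=> x x01; split=> [[m [j]]|/(freezeP c x01)[j Hj]].
  have [tm|ntm] := boolP (t m); last by rewrite /emit2 -/(t m) (negbTE ntm) => /itv_code0.
  by rewrite emitE// => H; apply/(freezeP c x01); exists j.
by exists s, j; rewrite emitE.
Qed.
End Freeze.

Section Cells.
Variables (R : realType) (D : nat -> nat -> bool) (A : set R).
Hypothesis A01 : forall x : R, A x -> 0 <= x <= 1.
Hypothesis dead_out : forall m j (x : R), (j < 2 ^ m)%N -> @cell R (2 ^ m) j x -> D m j -> ~ A x.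
Hypothesis out_dead : forall x : R, 0 <= x <= 1 -> ~ A x ->
  \forall y \near x & m \near \oo, forall j, (j < 2 ^ m)%N -> @cell R (2 ^ m) j y -> D m j.

Implicit Types (l m j : nat) (x y : R).

Lemma cell_div l m j x : (l <= m)%N -> @cell R (2 ^ m) j x ->
  @cell R (2 ^ l) (j %/ 2 ^ (m - l)) x.
Proof.
move=> lm /andP[h1 h2]; have e0 : (0 < 2 ^ (m - l))%N by rewrite expn_gt0.
have e0' : 0 < (2 ^ (m - l))%:R :> R by rewrite ltr0n.
have mE : x * (2 ^ m)%:R = x * (2 ^ l)%:R * (2 ^ (m - l))%:R.
  by rewrite -mulrA -natrM -expnD subnKC.
rewrite mE in h1 h2; apply/andP; split; rewrite -(ler_pM2r e0') -natrM.
  by apply: le_trans h1; rewrite ler_nat leq_divM.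
by apply: le_trans h2 _; rewrite ler_nat; apply: ltn_ceil.
Qed.

Lemma div_lt l m j : (l <= m)%N -> (j < 2 ^ m)%N -> (j %/ 2 ^ (m - l) < 2 ^ l)%N.
Proof. by move=> lm jm; rewrite ltn_divLR ?expn_gt0// -expnD subnKC. Qed.

Lemma alive_in m j x : (j < 2 ^ m)%N -> @cell R (2 ^ m) j x -> A x -> alive D m j.
Proof.
move=> jm xc Ax; apply/bforallP => l lm; apply/negP => Dl.
exact: (dead_out (div_lt lm jm) (cell_div lm xc) Dl).
Qed.

Lemma out_alive x : 0 <= x <= 1 -> ~ A x ->
  \forall y \near x & m \near \oo, forall j, (j < 2 ^ m)%N ->
    @cell R (2 ^ m) j y -> ~~ alive D m j.
Proof.
move=> x01 /(out_dead x01) H.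
have H0 : \forall y \near x & m \near \oo, (0 < m)%N.
  exists (setT, [set m | (0 < m)%N]); last by move=> [y m] [].
  by split; [exact: filterT|exact: nbhs_infty_gt].
apply: filterS2 H H0 => -[y m] /= Hm m0 j jm yc.
apply/negP => /bforallP/(_ m.-1); rewrite prednK// subnn expn0 divn1 leqnn => /(_ isT).
by rewrite (Hm j jm yc).
Qed.

Lemma alive_div l m j : (l <= m)%N -> alive D m j -> alive D l (j %/ 2 ^ (m - l)).
Proof.
move=> lm /bforallP H; apply/bforallP => i il.
have := H i (leq_trans il lm); rewrite -divnMA -expnD.
by have -> : (m - l + (l - i.+1) = m - i.+1)%N by lia.
Qed.

Lemma emptied_mono l m : (l <= m)%N -> emptied D l -> emptied D m.
Proof.
move=> lm; apply: contra => /bexistsP[j jm aj]; apply/bexistsP; exists (j %/ 2 ^ (m - l))%N.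
  exact: div_lt.
exact: alive_div.
Qed.

Lemma emptied0 : ~~ emptied D 0.
Proof. by rewrite /emptied negbK; apply/bexistsP; exists 0%N => //; exact/bforallP. Qed.

Lemma emptied_out m : emptied D m -> forall x, ~ A x.
Proof.
move=> /negP vm x Ax; have m0 : (0 < 2 ^ m)%N by rewrite expn_gt0.
have [j jm xc] := cell_exists m0 (A01 Ax).
by apply: vm; apply/bexistsP; exists j => //; apply: alive_in xc Ax.
Qed.

Lemma out_emptied : (forall x, ~ A x) -> exists m, emptied D m.
Proof.
move=> nA.
have /compact_near_coveringP cK := @segment_compact R 0 1.
have [x|M _ HM] := cK nat \oo (fun m y => forall j, (j < 2 ^ m)%N ->
    @cell R (2 ^ m) j y -> ~~ alive D m j) _.
  by rewrite /= in_itv /= => x01; exact: out_alive.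
exists M; apply/negP => /bexistsP[j jM]; apply/negP.
have M0 : 0 < (2 ^ M)%:R :> R by rewrite ltr0n expn_gt0.
have jc : @cell R (2 ^ M) j (j%:R / (2 ^ M)%:R).
  by rewrite /cell/= divfK ?gt_eqF// lexx ler_nat leqnSn.
apply: (HM M (leqnn M) _ _ j jM jc).
by rewrite /= in_itv /=; apply: cell_sub01 jM jc.
Qed.

Lemma emit_out m j x : ~~ emptied D m -> 0 <= x <= 1 -> itv_of_code (emit D m j) x ->
  exists i, [/\ (i < 2 ^ m)%N, @cell R (2 ^ m) i x & ~~ alive D m i].
Proof.
move=> /negbTE vm /andP[x0 x1]; rewrite /emit vm; case: ifP; last by move=> _ /itv_code0.
have e0 : (0 < 2 ^ m)%N by rewrite expn_gt0.
have e0' : 0 < (2 ^ m)%:R :> R by rewrite ltr0n.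
move=> /and3P[jm a1 a2] /itv_codeE; rewrite !(cpairK1, cpairK2) !qv_mkrat prednK//.
rewrite ltr_pdivrMr// ltr_pdivlMr// => /andP[h1 h2]; rewrite subr0 in h2.
have xm : x * (2 ^ m)%:R <= (2 ^ m)%:R by rewrite ler_piMl// ltW.
have [lt|ge] := ltP (x * (2 ^ m)%:R) j%:R.
  case: j jm a1 a2 h1 h2 lt => [|j] jm a1 a2 h1 h2 lt.
    by move: lt; rewrite ltNge mulr_ge0// ltW.
  exists j; split=> //; rewrite /cell/= ltW//= ?(ltW lt)//.
  by move: h1; rewrite -natr1 addrK.
have [jm'|] := ltnP j (2 ^ m).
  exists j; split=> //; first by rewrite /cell/= ge ltW.
  by move: a2; rewrite ltn_eqF.
move=> mj; have {mj}jE : j = (2 ^ m)%N by apply/eqP; rewrite eqn_leq jm.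
exists j.-1; split.
- by rewrite jE prednK.
- by rewrite /cell/= prednK ?jE// xm andbT (le_trans _ ge)// ler_nat -jE leq_pred.
- by move: a1; rewrite jE (gtn_eqF e0).
Qed.

Lemma out_emit x : 0 <= x <= 1 -> ~ A x -> (forall m, ~~ emptied D m) ->
  exists m j, itv_of_code (emit D m j) x.
Proof.
move=> x01 nA nv; have [[U V] /= [/nbhs_ballP[e /= e0 Ue] [M _ VM]] UV] := out_alive x01 nA.
have [k] : exists k : nat, e^-1 < k%:R by exists (Num.truncn e^-1).+1; exact: truncnS_gt.
move=> ke; pose m := maxn M k.
have m0 : 0 < (2 ^ m)%:R :> R by rewrite ltr0n expn_gt0.
have em : 1 < e * (2 ^ m)%:R.
  rewrite mulrC -ltr_pdivrMr// div1r (lt_trans ke)// ltr_nat.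
  by rewrite (leq_ltn_trans (leq_maxr M k))// ltn_expl.
have out y i : `|x - y| < e -> (i < 2 ^ m)%N -> @cell R (2 ^ m) i y -> ~~ alive D m i.
  by move=> xy; apply: (UV (y, m)); split; [exact: Ue|apply: VM; exact: leq_maxl].
have [x0 x1] := andP x01; have xm0 : 0 <= x * (2 ^ m)%:R by rewrite mulr_ge0// ltW.
have /andP[j1 j2] := truncn_itv xm0; set j := Num.truncn _ in j1 j2.
exists m, j; rewrite /emit (negbTE (nv m)).
have jm : (j <= 2 ^ m)%N.
  by rewrite -(ler_nat R) (le_trans j1)// ler_piMl// ltW.
have xj : `|x - j%:R / (2 ^ m)%:R| < e.
  rewrite -(ltr_pM2r m0) -[X in `|_| * X](gtr0_norm m0) -normrM mulrBl divfK ?gt_eqF//.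
  by rewrite ger0_norm ?subr_ge0// (lt_trans _ em)// ltrBlDl natr1.
rewrite jm /=; case: ifPn => [_|].
  apply/itv_codeE; rewrite !(cpairK1, cpairK2) !qv_mkrat prednK ?expn_gt0// subr0.
  by rewrite ltr_pdivrMr// ltr_pdivlMr// j2 andbT (lt_le_trans _ j1)// ltrBlDr ltrDl.
rewrite negb_and !negb_or !negbK => /orP[/andP[j0 aj]|/andP[jn aj]].
  have h1 : (j.-1 < 2 ^ m)%N by rewrite prednK ?lt0n.
  have h2 : @cell R (2 ^ m) j.-1 (j%:R / (2 ^ m)%:R).
    by rewrite /cell/= divfK ?gt_eqF// prednK ?lt0n// lexx ler_nat leq_pred.
  by move: aj; rewrite (negbTE (out _ _ xj h1 h2)).
have h1 : `|x - x| < e by rewrite subrr normr0.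
have h2 : (j < 2 ^ m)%N by rewrite ltn_neqAle jn.
have h3 : @cell R (2 ^ m) j x by rewrite /cell/= j1 ltW.
by move: aj; rewrite (negbTE (out _ _ h1 h2 h3)).
Qed.

Lemma emitP : A = `[0, 1]%classic \/ (forall x y, A x -> A y -> x = y) ->
  exists B : set R, [/\ full_or_point B, forall x, B x -> 0 <= x <= 1,
    (exists x, A x) -> B = A &
    forall x, 0 <= x <= 1 -> (exists m j, itv_of_code (emit D m j) x) <-> ~ B x].
Proof.
move=> hA; have [ex|nex] := pselect (exists m, emptied D m); last first.
  have nv m : ~~ emptied D m by apply/negP => vm; apply: nex; exists m.
  have [x0 Ax0] : exists x, A x.
    by apply: contrapT => nA; apply: nex; apply: out_emptied => x Ax; apply: nA; exists x.
  exists A; split=> //.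
    case: hA => [->|uA]; first by left.
    by right; exists x0; apply/seteqP; split=> [x Ax|x /= ->] //; apply: uA.
  move=> x x01; split=> [[m [j Hx]]|nA]; last exact: out_emit.
  have [i [im xc ai]] := emit_out (nv m) x01 Hx.
  by move=> Ax; move/negP: ai; apply; apply: alive_in xc Ax.
pose s := ex_minn ex; have [vs smin] : emptied D s /\ forall m, emptied D m -> (s <= m)%N.
  by rewrite /s; case: ex_minnP.
have nA : forall x, ~ A x := emptied_out vs.
have s0 : (0 < s)%N by rewrite lt0n; apply: contraL vs => /eqP ->; exact: emptied0.
have first m : emptied D m -> bmin m.+1 (emptied D) = s.
  move=> vm; have es : bexists s.+1 (emptied D) by apply/bexistsP; exists s.
  rewrite (@bmin_widen s.+1) ?ltnS ?smin//.
  by apply/eqP; rewrite eqn_leq smin ?(bminP es)// -ltnS bmin_lt es.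
set l := s.-1; have sE : s = l.+1 by rewrite prednK.
pose c := last_point D l.
have emitE m j : emptied D m -> emit D m j = freeze c j.
  by move=> vm; rewrite /emit vm /last_level first.
have exl : bexists (2 ^ l) (alive D l).
  by apply: contraT => vl; have := smin l vl; rewrite sE ltnn.
set js := bmin (2 ^ l) (alive D l).
have jsl : (js < 2 ^ l)%N by rewrite bmin_lt.
have ajs : alive D l js := bminP exl.
have l0 : 0 < (2 ^ l.+1)%:R :> R by rewrite ltr0n expn_gt0.
have cE : qv R c = (2 * js).+1%:R / (2 ^ l.+1)%:R.
  by rewrite qv_mkrat subr0 prednK ?expn_gt0.
have c01 : 0 <= qv R c <= 1.
  rewrite cE divr_ge0//= ler_pdivrMr// mul1r ler_nat expnS.
  by rewrite ltn_pmul2l.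
exists [set qv R c]; split; first by right; exists (qv R c).
- by move=> x ->.
- by move=> [x /nA].
move=> x x01; split=> [[m [j Hx]]|/(freezeP c x01)[j Hj]]; last by exists s, j; rewrite emitE.
have [vm|nvm] := boolP (emptied D m).
  by move: Hx; rewrite emitE// => H; apply/(freezeP c x01); exists j.
move=> /= xE; have [i [im xc /negP ai]] := emit_out nvm x01 Hx.
have ml : (m <= l)%N.
  by rewrite leqNgt -sE; apply: contra nvm => sm; apply: emptied_mono vs.
apply: ai; suff -> : i = (js %/ 2 ^ (l - m))%N by apply: alive_div.
move: xc => /andP[]; rewrite xE cE.
have -> : (2 * js).+1%:R / (2 ^ l.+1)%:R * (2 ^ m)%:R = (2 * js).+1%:R / (2 ^ (l.+1 - m))%:R :> R.
  rewrite -{1}(subnKC (leqW ml)) expnD natrM; field.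
  by rewrite !pnatr_eq0 -!lt0n !expn_gt0.
rewrite ler_pdivlMr ?ltr0n ?expn_gt0// ler_pdivrMr ?ltr0n ?expn_gt0// -!natrM !ler_nat.
rewrite subSn// expnS; set d := (2 ^ (l - m))%N => h1 h2.
have d0 : (0 < d)%N by rewrite expn_gt0.
apply/eqP; rewrite eqn_leq; apply/andP; split; first by rewrite leq_divRL//; nia.
by rewrite -ltnS ltn_divLR//; nia.
Qed.
End Cells.

Lemma selectP (M : nat) (S : nat -> Prop) (bit : nat -> bool) :
  (forall k, (k < M)%N -> bit k -> (exists2 t, (t <= k)%N & S t) -> S k) ->
  (forall k, (k < M)%N -> ~~ bit k -> (exists2 t, (t <= k)%N & S t) ->
     exists2 t, (t < k)%N & S t) ->
  (exists2 t, (t < M)%N & S t) ->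
  S (M.-1 - bmin M (fun d => bit (M.-1 - d)%N))%N.
Proof.
move=> H1 H0 exS; have M0 : (0 < M)%N by case: exS => t /(leq_ltn_trans (leq0n t)).
set d0 := bmin _ _.
have down d : (d <= M)%N -> (d <= d0)%N -> exists2 t, (t < M - d)%N & S t.
  elim: d => [|d IH] dM dd0; first by rewrite subn0.
  have kM : (M.-1 - d < M)%N by lia.
  have nb : ~~ bit (M.-1 - d)%N by have := bmin_before dd0 => /= ->.
  have [t tk St] := IH (ltnW dM) (ltnW dd0).
  have [|t' t'k St'] := H0 _ kM nb; first by exists t => //; lia.
  by exists t' => //; lia.
have [lt|ge] := ltnP d0 M.
  have [t tk St] := down d0 (ltnW lt) (leqnn _).
  apply: H1; [lia| |by exists t => //; lia].
  by apply: (@bminP M (fun d => bit (M.-1 - d)%N)); rewrite -bmin_lt.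
by have [t] := down M (leqnn _) ge; rewrite subnn.
Qed.

Section Reduction2.
Variable R : realType.
Implicit Types (x y : R) (sg b t i : nat).

Lemma full_or_point_names q (B : set R) : full_or_point B ->
  (forall x, B x -> 0 <= x <= 1) ->
  (forall x, 0 <= x <= 1 -> (exists n, itv_of_code (q n) x) <-> ~ B x) ->
  exists A : closed_unit_subset R, sval A = B /\ closed_names q A.
Proof.
move=> fB B01 H.
have cB : closed B.
  by case: fB => [->|[a ->]]; [exact: itv_closed|exact: closed_eq].
have sB : B `<=` `[0, 1]%classic by move=> x /B01; rewrite /= in_itv.
exists (exist _ B (conj cB sB)); split=> //; rewrite /closed_names /=.
apply/seteqP; split=> x [x01 Hx]; (split; first by []);
  have {}x01 : 0 <= x <= 1 by move: x01; rewrite /= in_itv.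
  by apply/(H x x01); case: Hx => n _ nx; exists n.
by have /(H x x01)[n nx] := Hx; exists n.
Qed.

Section Component.
Variables (q : baire) (P : {poly R}).
Hypothesis qP : poly_names q P.
Let N := q 0%N.
Let S sg : set R := solutions P N sg.

Lemma solutions01 sg x : S sg x -> 0 <= x <= 1.
Proof. by case. Qed.

Let dead_out sg m j x := @dead_sound R q P qP sg m j x.
Let out_dead sg x := @dead_complete R q P qP sg x.

Lemma solutions_shape sg :
  S sg = `[0, 1]%classic \/ (forall x y, S sg x -> S sg y -> x = y).
Proof.
rewrite /S; have [->|P0] := eqVneq P 0; first by left; exact: solutions0.
by right=> x y; apply: solutions_unique => //; case: qP.
Qed.

Lemma emptiedP sg : (exists m, emptied (dead q sg) m) <-> forall x, ~ S sg x.
Proof.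
split=> [[m vm] x|nS].
  exact: (emptied_out (@solutions01 sg) (@dead_out sg) vm).
exact: (out_emptied (@out_dead sg) nS).
Qed.

Lemma lowP sg : (exists m, low q sg m) <-> forall t, (t < sg)%N -> forall x, ~ S t x.
Proof.
split=> [[m /bforallP lm] t tsg|].
  by apply/emptiedP; exists m; exact: lm.
elim: sg => [|sg IH] H; first by exists 0%N; exact/bforallP.
have [|m /bforallP lm] := IH; first by move=> t tsg; apply: H; exact: ltnW.
have [m' em'] := (emptiedP sg).2 (H sg (leqnn _)).
exists (maxn m m'); apply/bforallP => t; rewrite ltnS leq_eqVlt => /predU1P[->|tsg].
  exact: emptied_mono (leq_maxr _ _) em'.
exact: emptied_mono (leq_maxl _ _) (lm t tsg).
Qed.

Lemma inst_root sg : exists B : set R, [/\ full_or_point B,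
  forall x, B x -> 0 <= x <= 1, (exists x, S sg x) -> B = S sg &
  forall x, 0 <= x <= 1 -> (exists m j, itv_of_code (inst q 0 sg m j) x) <-> ~ B x].
Proof.
exact: (emitP (@solutions01 sg) (@dead_out sg) (@out_dead sg) (solutions_shape sg)).
Qed.

Lemma inst_sign b sg : b != 0%N -> exists B : set R, [/\ full_or_point B,
  forall x, B x -> 0 <= x <= 1,
  forall x, B x -> (exists2 t, (t <= sg)%N & exists y, S t y) ->
    (4^-1 < x -> exists y, S sg y) /\
    (x < 3 / 4 -> exists2 t, (t < sg)%N & exists y, S t y) &
  forall x, 0 <= x <= 1 -> (exists m j, itv_of_code (inst q b sg m j) x) <-> ~ B x].
Proof.
move=> /negbTE b0; have [B [Bcase BE]] := emit2P R (low q sg) (emptied (dead q sg)).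
exists B; split.
- by case: Bcase => -[-> _]; [left|right; exists 0|right; exists 1].
- by case: Bcase => -[-> _] x /=; rewrite ?in_itv//= => ->; rewrite ?lexx ler01.
- move=> x Bx [t tsg St].
  have nlow : (forall m, ~~ low q sg m) -> exists2 t, (t < sg)%N & exists y, S t y.
    move=> nl; apply: contrapT => H; have [|m] := (lowP sg).2.
      by move=> u usg y Sy; apply: H; exists u => //; exists y.
    by rewrite (negbTE (nl m)).
  have nemp : (forall m, ~~ emptied (dead q sg) m) -> exists y, S sg y.
    move=> nl; apply: contrapT => H; have [|m] := (emptiedP sg).2.
      by move=> y Sy; apply: H; exists y.
    by rewrite (negbTE (nl m)).
  case: Bcase => -[BB].
  + move=> H; split=> _; first by apply: nemp => m; case: (H m).
    by apply: nlow => m; case: (H m).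
  + move=> /emptiedP H; move: Bx; rewrite BB => /= ->; split.
      by rewrite ltNge invr_ge0 ler0n.
    move=> _; exists t => //; rewrite ltn_neqAle tsg andbT.
    by apply/eqP => E; case: St => y; rewrite E; exact: H.
  + move=> /lowP H; move: Bx; rewrite BB => /= ->; split=> [_|]; last first.
      by rewrite ltr_pdivlMr// mul1r ltr_nat.
    move: tsg St; rewrite leq_eqVlt => /predU1P[->//|tsg] [y Sy].
    by case: (H t tsg y).
- by move=> x x01; rewrite -BE// /inst b0.
Qed.
End Component.

Lemma choice_slot p n (P : nat -> {poly R}) t :
  p 0%N = n -> (forall i, (i < n)%N -> poly_names (slice p i) (P i)) ->
  exists A : closed_unit_subset R, [/\ closed_names (slice (to_choice p) t) A,
    full_or_point (sval A) &
    let i := cfst (cfst t) in let sg := csnd (cfst t) in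
    let S u := solutions (P i) (slice p i 0) u in
    (i < n)%N -> 
    if csnd t == 0%N then (exists x, S sg x) -> sval A = S sg
    else forall x, sval A x -> (exists2 u, (u <= sg)%N & exists y, S u y) ->
      (4^-1 < x -> exists y, S sg y) /\
      (x < 3 / 4 -> exists2 u, (u < sg)%N & exists y, S u y)].
Proof.
move=> p0 HP; set i := cfst (cfst t); set sg := csnd (cfst t).
have E w : slice (to_choice p) t w =
    if (i < n)%N then inst (slice p i) (csnd t) sg (cfst w) (csnd w) else 0%N.
  by rewrite sliceE /to_choice /= !(cpairK1, cpairK2) p0.
have [lt|ge] := ltnP i n; last first.
  have [|x||A [AE An]] := @full_or_point_names (slice (to_choice p) t) `[0, 1]%classic.
  - by left.
  - by rewrite /= in_itv.
  - move=> x x01; split=> [[w]|]; first by rewrite E ltnNge ge => /itv_code0.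
    by rewrite /= in_itv /= x01.
  exists A; split=> //; first by rewrite AE; left.
  by rewrite /= ltnNge ge.
have itvE B : (forall x, 0 <= x <= 1 ->
      (exists m j, itv_of_code (inst (slice p i) (csnd t) sg m j) x) <-> ~ B x) ->
    forall x, 0 <= x <= 1 ->
      (exists w, itv_of_code (slice (to_choice p) t w) x) <-> ~ B x.
  move=> H x x01; rewrite -H//; split=> [[w]|[m [j]]].
    by rewrite E lt => Hx; exists (cfst w), (csnd w).
  by move=> Hx; exists (cpair m j); rewrite E lt cpairK1 cpairK2.
case: (eqVneq (csnd t) 0%N) => [b0|b0].
  have [B [fB B01 BS /= BE]] := inst_root (HP i lt) sg.
  have [|A [AE An]] := full_or_point_names fB B01 (q := slice (to_choice p) t).
    by apply: itvE; rewrite b0.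
  by exists A; split=> //; rewrite AE.
have [B [fB B01 BS /= BE]] := inst_sign (HP i lt) sg b0.
have [|A [AE An]] := full_or_point_names fB B01 (q := slice (to_choice p) t).
  exact: itvE.
by exists A; split=> //; rewrite AE.
Qed.

Lemma slot_lt p i sg b : (i < p 0%N)%N -> (sg < nsigns p)%N -> (b < 2)%N ->
  (cpair (cpair i sg) b < cpair (cpair (p 0%N) (nsigns p)) 2)%N.
Proof. by move=> ip sgp b2; apply: ltn_cpair => //; apply: ltn_cpair. Qed.

Lemma leq_nsigns p i : (i < p 0%N)%N -> (2 ^ slice p i 0 <= nsigns p)%N.
Proof.
move=> ip; rewrite leq_exp2l// big_mkord (bigD1 (Ordinal ip)) //=.
exact: leq_addr.
Qed.

Lemma BRoot_star_le_AoUC_star : weihrauch_le (star (@BRoot R)) (star (@AoUC R)).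
Proof.
exists (fun p => Some (of_choice (evens p) (odds p))), (fun p => Some (to_choice p)).
split; [exact: of_choice_computable|exact: to_choice_computable|].
move=> G HG p xs [p0 pn] _; set n := size xs in p0.
have [P HP] : exists P : nat -> {poly R}, forall i, (i < n)%N ->
    onth xs i = Some (P i) /\ poly_names (slice p i) (P i).
  suff /choice[P HP] : forall i, exists Q : {poly R}, (i < n)%N ->
    onth xs i = Some Q /\ poly_names (slice p i) Q by exists P.
  move=> i; have [lt|_] := ltnP i n; last by exists 0.
  by have [Q xi] := onth_lt lt; exists Q => _; split=> //; exact: pn.
have HPn i lt := (HP i lt).2.
have [A HA] := choice (fun t => choice_slot t p0 HPn).
pose T := cpair (cpair (p 0%N) (nsigns p)) 2.
have Knames : @seq_names (closed_unit_space R) (to_choice p) (mkseq A T).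
  by apply: seq_names_mkseq => // t _; case: (HA t).
have [|r [ys [Gr [_ rn] /Forall2_mkseql[sy Hy]]]] := HG (to_choice p) _ Knames.
  have [y Hy] : exists y : nat -> unit_interval R, forall t, AoUC (A t) (y t).
    suff /choice[y Hy] : forall t, exists y : unit_interval R, AoUC (A t) y by exists y.
    move=> t; have [_ fA _] := HA t.
    have [a Aa] : exists a, sval (A t) a.
      case: fA => [->|[a ->]]; last by exists a.
      by exists 0; rewrite /= in_itv/= lexx ler01.
    have a01 : 0 <= a <= 1.
      by case: (A t) Aa => C [cC sC] /= /sC; rewrite /= in_itv.
    by exists (exist _ a a01).
  exists (mkseq y T); apply/Forall2_mkseql; rewrite size_mkseq; split=> // t z.
  by rewrite onth_mkseq; case: ifP => // _ [<-].
have ans i sg b : (i < n)%N -> (sg < nsigns p)%N -> (b < 2)%N ->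
    exists y : unit_interval R, real_names (answer r i sg b) (sval y) /\
      sval (A (cpair (cpair i sg) b)) (sval y).
  move=> lt sgM b2; have tT : (cpair (cpair i sg) b < size ys)%N.
    by rewrite sy; apply: slot_lt; rewrite ?p0.
  have [y yt] := onth_lt tT; exists y; split; first exact: (rn _ _ yt).
  by have [_] := Hy _ _ yt.
have [y Hyi] : exists y : nat -> unit_interval R, forall i, (i < n)%N ->
    real_names (answer r i (selected p r i) 0) (sval (y i)) /\ BRoot (P i) (y i).
  suff /choice[y Hyi] : forall i, exists y : unit_interval R, (i < n)%N ->
    real_names (answer r i (selected p r i) 0) (sval y) /\ BRoot (P i) y by exists y.
  move=> i; have [lt|_] := ltnP i n; last first.
    have o : 0 <= (0 : R) <= 1 by rewrite lexx ler01.
    by exists (exist _ 0 o).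
  have M0 : (0 < nsigns p)%N by rewrite expn_gt0.
  have selM : (selected p r i < nsigns p)%N.
    by rewrite /selected (leq_ltn_trans (leq_subr _ _)) ?prednK.
  have [y [yn Ay]] := ans i _ 0%N lt selM isT.
  exists y => _; split=> //; move=> [x [x01 Px]].
  pose S u := exists z, solutions (P i) (slice p i 0) u z.
  have bitP k : (k < nsigns p)%N -> exists2 z : R,
      rlt (mkrat 1 0 1) (answer r i k 1 2) -> 4^-1 < z &
      (~~ rlt (mkrat 1 0 1) (answer r i k 1 2) -> z < 3 / 4) /\
      sval (A (cpair (cpair i k) 1)) z.
    move=> kM; have [z [zn Az]] := ans i _ 1%N lt kM isT.
    have := zn 2%N; rewrite -/(qv R _) ltr_norml expr2 => /andP[z1 z2].
    exists (sval z); rewrite (rltE R) qv_mkrat subr0; first by lra.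
    by rewrite -leNgt; split=> //; lra.
  have Sel : S (selected p r i).
    apply: (selectP (bit := fun k => rlt (mkrat 1 0 1) (answer r i k 1 2))).
    + move=> k kM bk exS; have [z /(_ bk) z4 [_ Az]] := bitP k kM.
      have [_ _] := HA (cpair (cpair i k) 1); rewrite !(cpairK1, cpairK2) /= => /(_ lt).
      by move=> /(_ z Az exS)[+ _]; apply.
    + move=> k kM bk exS; have [z _ [/(_ bk) z4 Az]] := bitP k kM.
      have [_ _] := HA (cpair (cpair i k) 1); rewrite !(cpairK1, cpairK2) /= => /(_ lt).
      by move=> /(_ z Az exS)[_ +]; apply.
    + have [sg sgN Sx] := solutions_cover (slice p i 0) x01 Px.
      exists sg; last by exists x.
      by rewrite (leq_trans sgN)// leq_nsigns ?p0.
  have [_ _] := HA (cpair (cpair i (selected p r i)) 0).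
  rewrite !(cpairK1, cpairK2) /= => /(_ lt Sel) AE.
  by move: Ay; rewrite AE => -[].
exists (of_choice p r), (mkseq y n); split.
- by rewrite /= Gr /= evens_pair odds_pair.
- apply: seq_names_mkseq; first by rewrite /of_choice.
  move=> i lt; have [+ _] := Hyi i lt; congr real_names.
  by apply/funext => k; rewrite [RHS]sliceE /of_choice /= cpairK1 cpairK2.
- apply/Forall2_onth; rewrite size_mkseq; split=> // i Q z xi.
  rewrite onth_mkseq; case: ifP => // lt [<-].
  by have [Pi _] := HP i lt; move: xi; rewrite Pi => -[<-]; case: (Hyi i lt).
Qed.
End Reduction2.

Theorem theorem2 (R : realType) :
  weihrauch_equiv (star (@AoUC R)) (star (@BRoot R)).
Proof.
split; [exact: AoUC_star_le_BRoot_star|exact: BRoot_star_le_AoUC_star].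
Qed.
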